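(* Let $\alpha$ be irrational and let $f$ be an orientation preserving $C^\infty$-diffeomorphism of the unit circle $\mathbb{T}$ with rotation number $2\alpha$. Let $D_\omega=\bigoplus_{n\in\mathbb{Z}}D_{\omega,n}$ be the deformed Dirac operator associated with $f$ (described in the context), and for $n\in\mathbb{Z}$ let $d_n(\theta):=\delta_n(e^{\imath\theta})$, where $\delta_n=\frac{d(m\circ f^n)}{dm}$. Then a real number $\lambda$ is an eigenvalue of $D_\omega$ if and only if there exists $n\in\mathbb{Z}$ such that the homogeneous Hill equation $$H''+\big(\lambda^2d_n^2(\theta)-n^2\big)H=0$$ admits a nontrivial ($2\pi$-)periodic $C^2$ (and therefore necessarily $C^\infty$) solution $H$.
   Context: $m=\frac{d\theta}{2\pi}$ is the normalised Lebesgue measure on $\mathbb{T}=\{z=e^{\imath\theta}\}$, and $f^n$ is the $n$-th iterate of $f$ ($n\in\mathbb{Z}$). The Radon–Nikodym derivative $\delta_n=\frac{d(m\circ f^n)}{dm}$ is the smooth strictly positive function $\delta_n(z)=\frac{z(\partial f^n)(z)}{f^n(z)}$, with $\partial=\frac{d}{dz}=\frac{1}{\imath e^{\imath\theta}}\frac{d}{d\theta}$. $M_g$ denotes multiplication by $g$ on $L^2(\mathbb{T},m)$, and $H^1(\mathbb{T})=\{u\in AC(\mathbb{T})\mid u'\in L^2(\mathbb{T},m)\}$, where $AC(\mathbb{T})$ is the set of absolutely continuous functions on $\mathbb{T}$. Put $L_n:=\imath z\frac{d}{dz}-nI$ and $L_n^\star:=-\imath z\frac{d}{dz}-nI$, and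 $$D_{\omega,n}:=\begin{pmatrix}0&M_{\delta_n^{-1}}L_n\\ L_n^\star M_{\delta_n^{-1}}&0\end{pmatrix}\quad\text{on the domain }H^1(\mathbb{T})\oplus H^1(\mathbb{T})\subset L^2(\mathbb{T},m)\oplus L^2(\mathbb{T},m).$$ The deformed Dirac operator is $D_\omega:=\bigoplus_{n\in\mathbb{Z}}D_{\omega,n}$, acting on $\bigoplus_{n\in\mathbb{Z}}\big(L^2(\mathbb{T},m)\oplus L^2(\mathbb{T},m)\big)$ with domain $$\Big\{\xi=(\xi_n)_n\ \Big|\ \xi_n\in H^1(\mathbb{T})\oplus H^1(\mathbb{T}),\ \sum_{n\in\mathbb{Z}}\|D_{\omega,n}\xi_n\|^2<+\infty\Big\}.$$ No compactness of the resolvent of $D_\omega$ is assumed. *)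

(* Defs.v *)
From HB Require Import structures.
From mathcomp Require Import all_boot all_order all_algebra.
From mathcomp Require Import complex.
From mathcomp Require Import all_classical all_reals all_analysis measurable_realfun.

Set Implicit Arguments.
Unset Strict Implicit.
Unset Printing Implicit Defensive.

Import Order.TTheory GRing.Theory Num.Theory.
Import numFieldNormedType.Exports.

Local Open Scope classical_set_scope.
Local Open Scope complex_scope.
Local Open Scope ring_scope.

Notation normc := ComplexField.Normc.normc.

(* R[i] carries no structure of normed module over R, so the calculus of
   functions R -> R[i] goes through real and imaginary parts. The derivative is
   total, with an irrelevant value where it does not exist. *)
Definition cderive (R : realType) (g : R -> R[i]) (t : R) : R[i] :=
  derive1 (fun s => complex.Re (g s)) t +i* derive1 (fun s => complex.Im (g s)) t.

Definition Ck_fun (R : realType) (k : nat) (g : R -> R) : Prop :=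
  (forall j t, (j < k)%N -> derivable (derive1n j g) t 1) /\ continuous (derive1n k g).

Definition cCk (R : realType) (k : nat) (g : R -> R[i]) : Prop :=
  Ck_fun k (fun t => complex.Re (g t)) /\ Ck_fun k (fun t => complex.Im (g t)).

Definition cCinfty (R : realType) (g : R -> R[i]) : Prop :=
  forall k, cCk k g.

Definition abs_cont (R : realType) (a b : R) (g : R -> R[i]) : Prop :=
  forall eps : R, 0 < eps -> exists2 eta : R, 0 < eta &
  forall (n : nat) (l r : 'I_n -> R),
    (forall i, a <= l i /\ l i <= r i /\ r i <= b) ->
    trivIset setT (fun i => `]l i, r i[%classic) ->
    \sum_(i < n) (r i - l i) < eta ->
    \sum_(i < n) normc (g (r i) - g (l i)) < eps.

Record circle (R : realType) := Circle {
  cval :> R[i];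
  cvalP : normc cval == 1 }.

HB.instance Definition _ (R : realType) := [isSub for @cval R].
HB.instance Definition _ (R : realType) := [Choice of circle R by <:].

Lemma normc_cis (R : realType) (t : R) : normc (cos t +i* sin t) == 1.
Proof. by rewrite /= cos2Dsin2 sqrtr1. Qed.

Definition expi (R : realType) (t : R) : circle R := Circle (normc_cis t).

HB.instance Definition _ (R : realType) :=
  isPointed.Build (circle R) (expi 0).

Lemma normc_rot (R : realType) (t : R) (z : circle R) :
  normc (cval (expi t) * cval z) == 1.
Proof.
by rewrite ComplexField.Normc.normcM (eqP (cvalP _)) (eqP (cvalP _)) mulr1.
Qed.

Definition rot (R : realType) (t : R) (z : circle R) : circle R :=
  Circle (normc_rot t z).

(* The Borel sets of the circle are the sets whose preimage under
   t |-> e^(it) is Borel in R. *)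
Definition circle_measurable (R : realType) : set (set (circle R)) :=
  image_set_system setT (@expi R) measurable.

Lemma circle_measurable_salgebra (R : realType) :
  sigma_algebra setT (@circle_measurable R).
Proof. by apply: sigma_algebra_image; exact: sigma_algebra_measurable. Qed.

Lemma circle_measurable0 (R : realType) : @circle_measurable R set0.
Proof. by case: (circle_measurable_salgebra R). Qed.

Lemma circle_measurableC (R : realType) (A : set (circle R)) :
  circle_measurable A -> circle_measurable (~` A).
Proof.
by case: (circle_measurable_salgebra R) => _ + _ mA => /(_ _ mA); rewrite setTD.
Qed.

Lemma circle_measurable_bigcup (R : realType) (F : (set (circle R))^nat) :
  (forall i, circle_measurable (F i)) -> circle_measurable (\bigcup_i F i).
Proof. by case: (circle_measurable_salgebra R) => _ _; apply. Qed.

Fact circle_display : measure_display. Proof. exact. Qed.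

HB.instance Definition _ (R : realType) :=
  isMeasurable.Build circle_display (circle R) (@circle_measurable0 R)
    (@circle_measurableC R) (@circle_measurable_bigcup R).

Lemma measurable_expi (R : realType) :
  measurable_fun [set: measurableTypeR R] (@expi R : measurableTypeR R -> circle R).
Proof. by move=> _ A mA; exact: mA. Qed.

Lemma two_pi_inv_ge0 (R : realType) : 0 <= (pi *+ 2)^-1 :> R.
Proof. by rewrite invr_ge0 mulrn_wge0 // pi_ge0. Qed.

(* The normalised Lebesgue measure d(theta) / 2 pi on [0, 2 pi[, carried to
   the circle by t |-> e^(it). *)
Definition angle_measure (R : realType) :
    {measure set (measurableTypeR R) -> \bar R} :=
  mscale (NngNum (two_pi_inv_ge0 R))
    (mrestr (@lebesgue_measure R) (measurable_itv `[0%R, (pi *+ 2)%R[)).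

Definition circle_measure (R : realType) : set (circle R) -> \bar R :=
  pushforward (@angle_measure R) (@expi R).

HB.instance Definition _ (R : realType) := Measure.copy (@circle_measure R)
  (measure_function_pushforward__canonical__measure_function_Measure
    (@angle_measure R) (@measurable_expi R)).

(* Derivatives along the circle: [dtheta] is d/d(theta), computed at z by
   rotating z, and [dz] is d/dz = (i e^(i theta))^-1 d/d(theta). *)
Definition dtheta (R : realType) (u : circle R -> R[i]) (z : circle R) : R[i] :=
  cderive (fun t => u (rot t z)) 0.

Definition dz (R : realType) (u : circle R -> R[i]) (z : circle R) : R[i] :=
  ('i * cval z)^-1 * dtheta u z.

Record circle_diffeo (R : realType) := CircleDiffeo {
  cdiff :> circle R -> circle R;
  cdiffV : circle R -> circle R;
  cdiffK : cancel cdiff cdiffV;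
  cdiffVK : cancel cdiffV cdiff;
  cdiff_smooth : cCinfty (fun t => cval (cdiff (expi t)));
  cdiffV_smooth : cCinfty (fun t => cval (cdiffV (expi t))) }.

Definition citer (R : realType) (f : circle_diffeo R) (n : int) :
    circle R -> circle R :=
  match n with
  | Posz k => iter k (cdiff f)
  | Negz k => iter k.+1 (cdiffV f)
  end.

Definition is_lift (R : realType) (f : circle R -> circle R) (F : R -> R) : Prop :=
  continuous F /\ forall t, f (expi t) = expi (F t).

Definition orientation_preserving (R : realType) (f : circle R -> circle R) : Prop :=
  exists2 F : R -> R, is_lift f F & {homo F : x y / x < y}.

(* The rotation number is measured in turns (the rotation by the angle
   2 pi rho has rotation number rho) and is a class modulo 1: changing the
   lift F changes rho by an integer. *)
Definition has_rotation_number (R : realType) (f : circle R -> circle R)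
    (rho : R) : Prop :=
  exists2 F : R -> R, is_lift f F &
    forall t, (fun k : nat => (iter k F t - t) / (k%:R * (pi *+ 2))) @ \oo --> rho.

(* The smooth positive version z (d(f^n)/dz) / f^n of the Radon-Nikodym
   derivative d(m o f^n) / dm, as a complex-valued function. *)
Definition delta (R : realType) (f : circle_diffeo R) (n : int)
    (z : circle R) : R[i] :=
  cval z * dz (fun w => cval (citer f n w)) z / cval (citer f n z).

(* Elements of L^2(T, m) are represented by functions, up to a.e. equality;
   a function defined a.e. may be extended arbitrarily, whence the
   measurable representative v below. An element of H^1(T) is given by its
   absolutely continuous representative, on which the operators act. *)

Definition circle_ae_eq (R : realType) (u v : circle R -> R[i]) : Prop :=
  u = v %[ae @circle_measure R].

Definition normL2sq (R : realType) (u : circle R -> R[i]) : \bar R :=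
  (\int[@circle_measure R]_z ((normc (u z)) ^+ 2)%:E)%E.

Definition in_L2 (R : realType) (u : circle R -> R[i]) : Prop :=
  exists v : circle R -> R[i],
    [/\ measurable_fun setT (fun z => complex.Re (v z)),
        measurable_fun setT (fun z => complex.Im (v z)),
        (normL2sq v < +oo)%E & circle_ae_eq u v].

Definition in_H1 (R : realType) (u : circle R -> R[i]) : Prop :=
  abs_cont 0 (pi *+ 2) (fun t => u (expi t)) /\ in_L2 (dtheta u).

Definition L_op (R : realType) (n : int) (u : circle R -> R[i])
    (z : circle R) : R[i] :=
  'i * cval z * dz u z - n%:~R * u z.

Definition Lstar_op (R : realType) (n : int) (u : circle R -> R[i])
    (z : circle R) : R[i] :=
  - ('i * cval z * dz u z) - n%:~R * u z.

Definition mult_op (R : realType) (g u : circle R -> R[i]) (z : circle R) : R[i] :=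
  g z * u z.

Definition spinor (R : realType) : Type :=
  ((circle R -> R[i]) * (circle R -> R[i]))%type.

Definition spinor_normsq (R : realType) (x : spinor R) : \bar R :=
  (normL2sq x.1 + normL2sq x.2)%E.

Definition spinor_ae_eq (R : realType) (x y : spinor R) : Prop :=
  circle_ae_eq x.1 y.1 /\ circle_ae_eq x.2 y.2.

Definition D_omega_n (R : realType) (f : circle_diffeo R) (n : int)
    (x : spinor R) : spinor R :=
  let dinv z := (delta f n z)^-1 in
  (mult_op dinv (L_op n x.2), Lstar_op n (mult_op dinv x.1)).

Definition D_omega (R : realType) (f : circle_diffeo R)
    (xi : int -> spinor R) (n : int) : spinor R :=
  D_omega_n f n (xi n).

Definition D_omega_dom (R : realType) (f : circle_diffeo R) :
    set (int -> spinor R) :=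
  [set xi | [/\ forall n, in_H1 (xi n).1 /\ in_H1 (xi n).2,
                (\esum_(n in [set: int]) spinor_normsq (xi n) < +oo)%E &
                (\esum_(n in [set: int]) spinor_normsq (D_omega f xi n) < +oo)%E]].

Definition sum_ae_eq (R : realType) (xi eta : int -> spinor R) : Prop :=
  forall n, spinor_ae_eq (xi n) (eta n).

Definition D_omega_eigenvalue (R : realType) (f : circle_diffeo R)
    (mu : R[i]) : Prop :=
  exists xi : int -> spinor R,
    [/\ D_omega_dom f xi,
        ~ sum_ae_eq xi (fun _ => (fun _ => 0, fun _ => 0)) &
        sum_ae_eq (D_omega f xi)
          (fun n => (fun z => mu * (xi n).1 z, fun z => mu * (xi n).2 z))].

Definition d_fun (R : realType) (f : circle_diffeo R) (n : int) (t : R) : R[i] :=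
  delta f n (expi t).

(* H is complex-valued, like the elements of L^2(T, m). *)
Definition hill_solution (R : realType) (f : circle_diffeo R) (lambda : R)
    (n : int) (H : R -> R[i]) : Prop :=
  cCk 2 H /\
  forall t, cderive (cderive H) t
            + ((lambda%:C) ^+ 2 * (d_fun f n t) ^+ 2 - n%:~R ^+ 2) * H t = 0.

(* Main.v *)
From HB Require Import structures.
Require Import Defs.
From mathcomp Require Import all_boot all_order all_algebra.
From mathcomp Require Import complex ring lra.
From mathcomp Require Import all_classical all_reals all_analysis measurable_realfun.

Set Implicit Arguments.
Unset Strict Implicit.
Unset Printing Implicit Defensive.

Import Order.TTheory GRing.Theory Num.Theory.
Import numFieldNormedType.Exports.

Local Open Scope classical_set_scope.
Local Open Scope complex_scope.
Local Open Scope ring_scope.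

(** An eigenvector of the deformed Dirac operator lives in some summand of
    index n, and there the eigenvalue equation is an ordinary differential
    system. The iterate of index n of the diffeomorphism lifts to a smooth
    function F of the angle, so that delta_n is the function d = F' of the
    angle: it is real, smooth and without zeros ([deltaE]). If (u, v) is the
    eigenvector, put W = u / d and V = v; since d, n and lambda are real, the
    real and imaginary parts of V and W solve separately
      V' = n V + lambda d^2 W,     W' = - n W - lambda V,
    and differentiating the second equation gives the Hill equation for W.
    Conversely, for lambda <> 0, a solution h of the Hill equation gives the
    solution V = - (h' + n h) / lambda, W = h of the system. For lambda = 0 the
    system decouples into two equations y' = c y with c = n or c = - n, which
    have nonzero periodic solutions only when n = 0; the same applies to
    H'' = n^2 H, and for n = 0 constants solve everything.

    The analytic point is that the eigenvalue equation holds only almost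
    everywhere, for absolutely continuous functions whose pointwise derivative
    is not known to exist. An absolutely continuous function f is the
    difference of its variation function and of another nondecreasing function,
    both absolutely continuous. The Stieltjes measure of a nondecreasing
    absolutely continuous function is dominated by the Lebesgue measure
    ([stieltjes_dominated]): a null set is covered by disjoint intervals of
    small total length, on which the function has small total increment. The
    Radon-Nikodym theorem then makes f the integral of a density g, and the
    Lebesgue differentiation theorem gives f' = g almost everywhere
    ([ac_FTC]). Hence, if f' = h almost everywhere with h continuous, f is a
    primitive of h ([ac_derive1_eq]); for periodic f this holds on the
    whole line ([periodic_ac_derive]). The right-hand sides of the system are
    continuous, so V and W are differentiable everywhere and satisfy the
    system in the classical sense.

    Smoothness of the solutions of the Hill equation is a bootstrap: H'' is the
    product of H and of a smooth function ([hill_smooth]). *)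

(** * Calculus of smooth functions of a real variable *)

Section smooth_functions.
Variable R : realType.
Implicit Types (f g h F G : R -> R) (t : R).

Lemma derive1_val f t d : is_derive t (1:R) f d -> derive1 f t = d.
Proof. by move=> [_ <-]; rewrite derive1E. Qed.

Lemma derivable_is_derive f t : derivable f t 1 -> is_derive t (1:R) f (derive1 f t).
Proof. by move=> df; apply: DeriveDef; [exact: df|rewrite derive1E]. Qed.

Lemma is_deriveDl f g t df dg : is_derive t (1:R) f df -> is_derive t (1:R) g dg ->
  is_derive t (1:R) (fun x => f x + g x) (df + dg).
Proof. exact: is_deriveD. Qed.

Lemma is_deriveNl f t df : is_derive t (1:R) f df ->
  is_derive t (1:R) (fun x => - f x) (- df).
Proof. exact: is_deriveN. Qed.

Lemma is_deriveMl f g t df dg : is_derive t (1:R) f df -> is_derive t (1:R) g dg ->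
  is_derive t (1:R) (fun x => f x * g x) (df * g t + f t * dg).
Proof.
move=> fd gd; have H := is_deriveM fd gd.
apply: (is_derive_eq H).
by rewrite addrC /GRing.scale /=; congr (_ + _); rewrite mulrC.
Qed.

Lemma is_derive_const (c t : R) : is_derive t (1:R) (fun=> c) 0.
Proof. exact: is_derive_cst. Qed.

Lemma is_derive_scale (c : R) f t df : is_derive t (1:R) f df ->
  is_derive t (1:R) (fun x => c * f x) (c * df).
Proof.
move=> fd; apply: (is_derive_eq (is_deriveMl (is_derive_const c t) fd)).
by rewrite mul0r add0r.
Qed.

Lemma is_derive_shift f (c : R) t df : is_derive (t + c) (1:R) f df ->
  is_derive t (1:R) (fun x => f (x + c)) df.
Proof.
move=> fd; have sd := is_deriveDl (is_derive_id t (1:R)) (is_derive_const c t).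
apply: (is_derive_eq (@is_derive1_comp R f (fun x => x + c) t df (1 + 0) fd sd)).
by rewrite addr0 mulr1.
Qed.

Lemma is_derive_continuous f df : (forall t, is_derive t (1:R) f (df t)) -> continuous f.
Proof.
by move=> fd t; apply/differentiable_continuous/derivable1_diffP; case: (fd t).
Qed.

Lemma is_derive_eq_cst f : (forall t, is_derive t (1:R) f 0) -> forall s t, f s = f t.
Proof. by move=> fd s t; apply: is_derive_0_is_cst. Qed.

(** The recursion on which the closure properties below rest: each of them
    reduces at order k + 1 to the formula for the first derivative and to the
    property at order k. *)
Lemma Ck_funS k f :
  Ck_fun k.+1 f <-> (forall t, derivable f t 1) /\ Ck_fun k (derive1 f).
Proof.
have E j : derive1n j.+1 f = derive1n j (derive1 f) by rewrite /derive1n iterSr.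
split=> [[df cf]|[df [ddf cdf]]].
  split=> [t|]; first exact: (df 0).
  by split=> [j t jk|]; rewrite -E //; exact: df.
split=> [[|j] t jk|]; first exact: df.
  by rewrite E; exact: ddf.
by rewrite E.
Qed.

Lemma Ck_fun0 f : Ck_fun 0 f <-> continuous f.
Proof. by split=> [[]//|cf]; split. Qed.

Lemma Ck_fun_continuous k f : Ck_fun k f -> continuous f.
Proof.
case: k => [|k]; first by move/Ck_fun0.
move=> /Ck_funS[df _]; apply: (@is_derive_continuous f (derive1 f)) => t.
exact: derivable_is_derive.
Qed.

Lemma Ck_funW k f : Ck_fun k.+1 f -> Ck_fun k f.
Proof.
elim: k f => [|k ih] f; first by move/Ck_fun_continuous/Ck_fun0.
by move=> /Ck_funS[df /ih cf]; apply/Ck_funS.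
Qed.

Lemma Ck_fun_is_derive k f df : (forall t, is_derive t (1:R) f (df t)) ->
  Ck_fun k df -> Ck_fun k.+1 f.
Proof.
move=> fd cf; apply/Ck_funS; split=> [t|]; first by case: (fd t).
by rewrite (_ : derive1 f = df)//; apply/funext => t; exact: derive1_val.
Qed.

Lemma Ck_fun_derive k f : Ck_fun k.+1 f -> forall t, is_derive t (1:R) f (derive1 f t).
Proof. by move=> /Ck_funS[df _] t; exact: derivable_is_derive. Qed.

Lemma Ck_fun_cst k (c : R) : Ck_fun k (fun _ : R => c).
Proof.
elim: k c => [|k ih] c; first by apply/Ck_fun0; exact: cst_continuous.
by apply: Ck_fun_is_derive (ih 0) => t; exact: is_derive_const.
Qed.

Lemma Ck_funD k f g : Ck_fun k f -> Ck_fun k g -> Ck_fun k (fun x => f x + g x).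
Proof.
elim: k f g => [|k ih] f g.
  by move=> /Ck_fun0 cf /Ck_fun0 cg; apply/Ck_fun0 => t; exact: cvgD (cf t) (cg t).
move=> /[dup]/Ck_fun_derive fd /Ck_funS[_ cf] /[dup]/Ck_fun_derive gd /Ck_funS[_ cg].
by apply: Ck_fun_is_derive (ih _ _ cf cg) => t; exact: is_deriveDl.
Qed.

Lemma Ck_funM k f g : Ck_fun k f -> Ck_fun k g -> Ck_fun k (fun x => f x * g x).
Proof.
elim: k f g => [|k ih] f g.
  by move=> /Ck_fun0 cf /Ck_fun0 cg; apply/Ck_fun0 => t; exact: cvgM (cf t) (cg t).
move=> /[dup]/[dup]/Ck_fun_derive fd /Ck_funW cf0 /Ck_funS[_ cf].
move=> /[dup]/[dup]/Ck_fun_derive gd /Ck_funW cg0 /Ck_funS[_ cg].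
apply: (Ck_fun_is_derive (fun t => is_deriveMl (fd t) (gd t))).
by apply: Ck_funD; exact: ih.
Qed.

Lemma Ck_funZ k (c : R) f : Ck_fun k f -> Ck_fun k (fun x => c * f x).
Proof. by move=> cf; apply: Ck_funM => //; exact: Ck_fun_cst. Qed.

Lemma Ck_funB k f g : Ck_fun k f -> Ck_fun k g -> Ck_fun k (fun x => f x - g x).
Proof.
move=> cf cg; rewrite (_ : (fun x => _) = (fun x => f x + (-1) * g x)).
  by apply: Ck_funD => //; exact: Ck_funZ.
by apply/funext => x; rewrite mulN1r.
Qed.

Lemma Ck_fun_comp k f g : Ck_fun k f -> Ck_fun k g -> Ck_fun k (fun x => f (g x)).
Proof.
elim: k f g => [|k ih] f g.
  by move=> /Ck_fun0 cf /Ck_fun0 cg; apply/Ck_fun0 => t; exact: continuous_comp (cg t) (cf _).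
move=> /[dup]/Ck_fun_derive fd /Ck_funS[_ cf].
move=> /[dup]/[dup]/Ck_fun_derive gd /Ck_funW cg0 /Ck_funS[_ cg].
apply: (Ck_fun_is_derive (fun t => is_derive1_comp (fd (g t)) (gd t))).
by apply: Ck_funM; [exact: ih|exact: cg].
Qed.

Lemma Ck_funV k f : (forall t, f t != 0) -> Ck_fun k f -> Ck_fun k (fun t => (f t)^-1).
Proof.
move=> f0; elim: k => [|k ih].
  by move=> /Ck_fun0 cf; apply/Ck_fun0 => t; exact: cvgV (f0 t) (cf t).
move=> /[dup]/[dup]/Ck_fun_derive fd /Ck_funW/ih cV /Ck_funS[_ cf].
apply: (Ck_fun_is_derive (fun t => is_deriveV (f0 t) (fd t))).
rewrite (_ : (fun t => _) = (fun t => -1 * ((f t)^-1 * (f t)^-1 * derive1 f t))).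
  by apply: Ck_funZ; apply: Ck_funM cf; exact: Ck_funM.
by apply/funext => t; rewrite /GRing.scale /= mulN1r mulNr expr2 invfM.
Qed.

(** The integral from a fixed base point only makes sense on one side of it.
    Here G x is the integral over [0, x] minus the integral over [x, 0], one
    of the two intervals being empty or reduced to a point; near any point
    this differs by a constant from the integral over [a, x], for a small
    enough. *)
Lemma continuous_antiderivative g : continuous g ->
  exists G, forall t, is_derive t (1:R) G (g t).
Proof.
move=> cg.
have ig (a b : R) : (@lebesgue_measure R).-integrable `[a, b] (EFin \o g).
  apply: continuous_compact_integrable; first exact: segment_compact.
  exact: continuous_subspaceT.
pose I a b := \int[@lebesgue_measure R]_(t in `[a, b]) g t.
pose G x := I 0 x - I x 0.
have IB a x y : a <= x -> x <= y -> I a y - I a x = I x y.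
  move=> ax xy; rewrite /I Rintegral_itvB ?bnd_simp//.
  rewrite Rintegral_itv_obnd_cbnd//.
  by apply: integrableS (ig x y) => //; exact: subset_itv_oc_cc.
have I0 x : I x x = 0 by rewrite /I set_itv1 Rintegral_set1.
have Ie x y : y < x -> I x y = 0.
  by move=> yx; rewrite /I set_itv_ge ?Rintegral_set0// bnd_simp -ltNge.
have GE a x : a <= 0 -> a <= x -> G x = I a x - I a 0.
  move=> a0 ax; rewrite /G; have [x0|x0] := leP 0 x.
    rewrite IB//; move: x0; rewrite le_eqVlt => /predU1P[<-|x0]; first by rewrite I0 subrr.
    by rewrite (Ie x)// subr0.
  by rewrite (Ie 0)// sub0r -(IB a x 0)// ?ltW// opprB.
exists G => x.
pose a := Num.min x 0 - 1.
have ax : a < x by rewrite /a ltrBlDr (@le_lt_trans _ _ x)// ?ge_min ?lexx// ltrDl.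
have a0 : a <= 0 by rewrite /a lerBlDr (@le_trans _ _ 0)// ge_min lexx orbT.
have xx1 : x < x + 1 by rewrite ltrDl.
have [dI DI] := @continuous_FTC1_closed R g a x (x + 1) xx1 (ig a _) ax (cg x).
have dIa : is_derive x (1:R) (I a) (g x) by apply: DeriveDef; [exact: dI|rewrite -derive1E].
have dJ := is_deriveDl dIa (is_derive_const (- I a 0) x).
rewrite addr0 in dJ.
have near_eq : \forall y \near x, (fun y => I a y + - I a 0) y = G y.
  near=> y; rewrite (GE a)//.
  by apply/ltW; near: y; exact: lt_nbhsr.
case: dJ => dJ DJ; apply: DeriveDef; first exact: near_eq_derivable near_eq dJ.
by rewrite -(near_eq_derive _ near_eq).
Unshelve. all: by end_near. Qed.

Definition smooth f := forall k, Ck_fun k f.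

Lemma smooth_derive f : smooth f -> forall t, is_derive t (1:R) f (derive1 f t).
Proof. by move=> sf; exact: Ck_fun_derive (sf 1). Qed.

Lemma smooth_derive1 f : smooth f -> smooth (derive1 f).
Proof. by move=> sf k; have /Ck_funS[] := sf k.+1. Qed.

Lemma smooth_antiderivative F f : (forall t, is_derive t (1:R) F (f t)) ->
  smooth f -> smooth F.
Proof. by move=> Ff sf k; apply: Ck_funW; exact: Ck_fun_is_derive (sf k). Qed.

Lemma smooth_id : smooth (fun t : R => t).
Proof.
move=> k; apply: Ck_funW.
by apply: (Ck_fun_is_derive (fun t => is_derive_id t (1:R))); exact: Ck_fun_cst.
Qed.

Lemma smooth_iter k f : smooth f -> smooth (iter k f).
Proof.
move=> sf; elim: k => [|k ih]; first exact: smooth_id.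
by move=> j; exact: (Ck_fun_comp (sf j) (ih j)).
Qed.

Lemma angle_exists (x y : R) : x ^+ 2 + y ^+ 2 = 1 ->
  exists t, cos t = x /\ sin t = y.
Proof.
move=> xy1.
have x1 : -1 <= x <= 1.
  by rewrite -ler_norml -(@ler_pXn2r _ 2)// ?nnegrE// expr1n real_normK ?num_real//;
     have := sqr_ge0 y; lra.
have s2 : sin (acos x) = `|y|.
  by rewrite sin_acos// (_ : 1 - x ^+ 2 = y ^+ 2) ?sqrtr_sqr//; lra.
have [y0|y0] := leP 0 y.
  by exists (acos x); rewrite acosK// s2 ger0_norm.
by exists (- acos x); rewrite cosN sinN acosK// s2 ltr0_norm// opprK.
Qed.

(** The argument F of the unit vector (hr, hi) must have the derivative w
    below, the imaginary part of h' times the conjugate of h. With F defined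
    as a primitive of w, the scalar product of (hr, hi) and (cos F, sin F) has
    zero derivative; F is normalised to make it 1 at the origin, and two unit
    vectors with scalar product 1 are equal. *)
Lemma smooth_lift hr hi : smooth hr -> smooth hi ->
    (forall t, hr t ^+ 2 + hi t ^+ 2 = 1) ->
  exists F, smooth F /\ forall t, cos (F t) = hr t /\ sin (F t) = hi t.
Proof.
move=> shr shi h1.
have dhr := smooth_derive shr; have dhi := smooth_derive shi.
pose w t := derive1 hi t * hr t - derive1 hr t * hi t.
have sw : smooth w.
  by move=> k; apply: Ck_funB; apply: Ck_funM => //; exact: smooth_derive1.
have [G dG] := continuous_antiderivative (Ck_fun_continuous (sw 0)).
have [a [ca sa]] := angle_exists (h1 0).
pose F t := G t + (a - G 0).
have dF t : is_derive t (1:R) F (w t).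
  by apply: (is_derive_eq (is_deriveDl (dG t) (is_derive_const _ t))); rewrite addr0.
exists F; split; first exact: smooth_antiderivative sw.
have orth t : hr t * derive1 hr t + hi t * derive1 hi t = 0.
  have H := is_deriveDl (is_deriveMl (dhr t) (dhr t)) (is_deriveMl (dhi t) (dhi t)).
  have E : (fun x => hr x * hr x + hi x * hi x) = (fun=> 1).
    by apply/funext => x; rewrite -!expr2 h1.
  rewrite E in H; have := derive1_val H; rewrite (derive1_val (is_derive_const 1 t)).
  by move=> H0; lra.
have hrE t : derive1 hr t = - w t * hi t.
  have := orth t; have := h1 t; rewrite /w => e1 e2.
  apply: (@eq_trans _ _ (derive1 hr t * (hr t ^+ 2 + hi t ^+ 2))); first by rewrite e1 mulr1.
  apply/eqP; rewrite -subr_eq0; apply/eqP.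
  transitivity (hr t * (hr t * derive1 hr t + hi t * derive1 hi t)); first by ring.
  by rewrite e2 mulr0.
have hiE t : derive1 hi t = w t * hr t.
  have := orth t; have := h1 t; rewrite /w => e1 e2.
  apply: (@eq_trans _ _ (derive1 hi t * (hr t ^+ 2 + hi t ^+ 2))); first by rewrite e1 mulr1.
  apply/eqP; rewrite -subr_eq0; apply/eqP.
  transitivity (hi t * (hr t * derive1 hr t + hi t * derive1 hi t)); first by ring.
  by rewrite e2 mulr0.
have dcos t := is_derive1_comp (is_derive_cos (F t)) (dF t).
have dsin t := is_derive1_comp (is_derive_sin (F t)) (dF t).
have key t : hr t * cos (F t) + hi t * sin (F t) = 1.
  rewrite (@is_derive_eq_cst (fun x => hr x * cos (F x) + hi x * sin (F x)) _ t 0).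
    rewrite /F; rewrite (_ : G 0 + (a - G 0) = a); last by ring.
    by rewrite ca sa -!expr2 h1.
  move=> s; apply: (is_derive_eq (is_deriveDl (is_deriveMl (dhr s) (dcos s))
    (is_deriveMl (dhi s) (dsin s)))).
  by rewrite hrE hiE /=; ring.
move=> t; have := cos2Dsin2 (F t); have := h1 t; have := key t.
move: (cos (F t)) (sin (F t)) (hr t) (hi t) => c s x y e1 e2 e3.
have /eqP : (x - c) ^+ 2 + (y - s) ^+ 2 = 0.
  by transitivity ((x^+2 + y^+2) + (c^+2 + s^+2) - 2 * (x * c + y * s)); [ring|rewrite e1 e2 e3; ring].
rewrite paddr_eq0 ?sqr_ge0// !sqrf_eq0 !subr_eq0 => /andP[/eqP-> /eqP->//].
Qed.

End smooth_functions.

(** * Absolutely continuous functions *)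

Section absolute_continuity.
Variable R : realType.
Implicit Types (f g : R -> R) (a b : R).

Definition ac_modulus f a b (eps eta : R) : Prop :=
  forall (n : nat) (l r : 'I_n -> R),
    (forall i, a <= l i /\ l i <= r i /\ r i <= b) ->
    trivIset setT (fun i => `]l i, r i[%classic) ->
    \sum_(i < n) (r i - l i) < eta ->
    \sum_(i < n) `|f (r i) - f (l i)| < eps.

Definition ac f a b : Prop :=
  forall eps, 0 < eps -> exists2 eta, 0 < eta & ac_modulus f a b eps eta.

Lemma ac_modulus_fin f a b eps eta (I : finType) (l r : I -> R) :
    ac_modulus f a b eps eta ->
    (forall i, a <= l i /\ l i <= r i /\ r i <= b) ->
    trivIset setT (fun i => `]l i, r i[%classic) ->
    \sum_i (r i - l i) < eta ->
  \sum_i `|f (r i) - f (l i)| < eps.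
Proof.
move=> fm lr tlr; rewrite (reindex _ (onW_bij _ (@enum_val_bij I)))/= => slr.
rewrite (reindex _ (onW_bij _ (@enum_val_bij I)))/=.
apply: fm slr => // i j _ _ ij; apply: enum_val_inj.
exact: (tlr _ _ Logic.I Logic.I ij).
Qed.

Lemma itv_partition_nth_leq c d (s : seq R) i j : itv_partition c d s ->
  (i <= j <= size s)%N -> nth d (c :: s) i <= nth d (c :: s) j.
Proof.
move=> [cs _] /andP[ij js].
apply: (sorted_leq_nth le_trans lexx) => //; rewrite ?inE /= ?ltnS ?(leq_trans ij)//.
by apply: sub_path cs => x y /ltW.
Qed.

Lemma itv_partition_last c d (s : seq R) : itv_partition c d s ->
  nth d (c :: s) (size s) = d.
Proof. by move=> [_ /eqP sd]; rewrite nth_last /= sd. Qed.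

(** Partitioning each interval of the family gives again a family of disjoint
    intervals, of the same total length, indexed by pairs; the modulus applies
    to this finer family. *)
Lemma ac_modulus_variation f a b eps eta n (l r : 'I_n -> R) (s : 'I_n -> seq R) :
    ac_modulus f a b eps eta ->
    (forall i, a <= l i /\ r i <= b) ->
    (forall i, itv_partition (l i) (r i) (s i)) ->
    trivIset setT (fun i => `]l i, r i[%classic) ->
    \sum_(i < n) (r i - l i) < eta ->
  \sum_(i < n) variation (l i) (r i) f (s i) < eps.
Proof.
move=> fm lr ps tlr slr.
pose L (p : {i : 'I_n & 'I_(size (s i))}) :=
  nth (r (tag p)) (l (tag p) :: s (tag p)) (tagged p).
pose U (p : {i : 'I_n & 'I_(size (s i))}) :=
  nth (r (tag p)) (l (tag p) :: s (tag p)) (tagged p).+1.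
have Ll p : l (tag p) <= L p.
  by rewrite -[leLHS]/(nth (r (tag p)) (l (tag p) :: s (tag p)) 0)
    itv_partition_nth_leq//= ltnW.
have LU p : L p <= U p by rewrite itv_partition_nth_leq// leqnSn ltn_ord.
have Ur p : U p <= r (tag p).
  rewrite -[leRHS](itv_partition_last (ps (tag p))).
  by rewrite itv_partition_nth_leq// ltn_ord /=.
under eq_bigr do rewrite /variation big_mkord.
rewrite (sig_big_dep _ _ (fun i (j : 'I_(size (s i))) =>
  `|f (nth (r i) (l i :: s i) j.+1) - f (nth (r i) (l i :: s i) j)|))/=.
apply: (ac_modulus_fin (l := L) (r := U) fm).
- move=> p; have [al rb] := lr (tag p).
  by rewrite (le_trans al)// LU (le_trans (Ur p)).
- move=> [i j] [i' j'] _ _ [x []]; rewrite /= !in_itv/= => xij xij'.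
  have ii' : i = i'.
    apply: (tlr i i' Logic.I Logic.I); exists x; split; rewrite /= in_itv/=.
    - have /andP[x1 x2] := xij.
      by rewrite (le_lt_trans (Ll _) x1) (lt_le_trans x2 (Ur _)).
    - have /andP[x1 x2] := xij'.
      by rewrite (le_lt_trans (Ll _) x1) (lt_le_trans x2 (Ur _)).
  subst i'; congr existT; apply/val_inj/eqP.
  move: xij xij'; rewrite /L /U /= => /andP[x1 x2] /andP[x3 x4].
  rewrite eqn_leq; apply/andP; split; rewrite leqNgt; apply/negP => jj.
  - have : nth (r i) (l i :: s i) j'.+1 <= nth (r i) (l i :: s i) j.
      by rewrite itv_partition_nth_leq// jj ltnW.
    by move/(lt_le_trans x4)/lt_trans => /(_ _ x1); rewrite ltxx.
  - have : nth (r i) (l i :: s i) j.+1 <= nth (r i) (l i :: s i) j'.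
      by rewrite itv_partition_nth_leq// jj ltnW.
    by move/(lt_le_trans x2)/lt_trans => /(_ _ x3); rewrite ltxx.
- rewrite [ltLHS](_ : _ = \sum_(i < n) \sum_(j < size (s i))
    (nth (r i) (l i :: s i) j.+1 - nth (r i) (l i :: s i) j)); last first.
    by rewrite (sig_big_dep _ _ (fun i (j : 'I_(size (s i))) =>
      nth (r i) (l i :: s i) j.+1 - nth (r i) (l i :: s i) j)).
  rewrite (eq_bigr (fun i => r i - l i))// => i _.
  rewrite -(big_mkord xpredT (fun j => nth (r i) (l i :: s i) j.+1 - nth (r i) (l i :: s i) j)).
  by rewrite telescope_sumr// itv_partition_last.
Qed.

Lemma ac_TV1 f a b eps eta c d : ac_modulus f a b eps eta ->
  a <= c -> c <= d -> d <= b -> d - c < eta ->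
  (total_variation c d f <= eps%:E)%E.
Proof.
move=> fm ac cd db dc; apply: ge_ereal_sup => _ [_ [s ps <-] <-].
have := @ac_modulus_variation f a b eps eta 1 (fun=> c) (fun=> d) (fun=> s) fm.
rewrite !big_ord1 lee_fin => h; apply/ltW/h => //.
by move=> i j _ _ _; rewrite !ord1.
Qed.

(** On an interval of length less than a modulus for 1 the variation is at
    most 1, and finitely many such intervals cover [a, b]. *)
Lemma ac_TV_fin f a b : a <= b -> ac f a b ->
  forall x, a <= x <= b -> total_variation a x f \is a fin_num.
Proof.
move=> ab /(_ _ ltr01)[eta eta0 fm].
have H k : total_variation a (Num.min b (a + k%:R * (eta / 2))) f \is a fin_num.
  elim: k => [|k ih].
    by rewrite mul0r addr0 min_r// total_variationxx.
  have e2 : 0 < eta / 2 by rewrite divr_gt0.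
  have h1 : a <= Num.min b (a + k%:R * (eta / 2)).
    by rewrite le_min ab lerDl mulr_ge0// ltW.
  have h2 : Num.min b (a + k%:R * (eta / 2)) <= Num.min b (a + k.+1%:R * (eta / 2)).
    by rewrite le_min !ge_min lexx /= lerD2l ler_pM2r// ler_nat leqnSn orbT.
  have h3 : Num.min b (a + k.+1%:R * (eta / 2)) <= b by rewrite ge_min lexx.
  rewrite (total_variationD f h1 h2) fin_numD ih /=.
  rewrite ge0_fin_numE ?total_variation_ge0//.
  apply: (@le_lt_trans _ _ 1%:E); last by rewrite ltry.
  apply: (ac_TV1 fm) => //.
  rewrite -natr1 mulrDl mul1r addrA.
  have : eta / 2 < eta by rewrite ltr_pdivrMr// ltr_pMr// ltr1n.
  by rewrite /Num.min; case: ifP => ?; case: ifP => ?; lra.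
move=> x /andP[ax xb].
have := H (Num.bound `|(b - a) / (eta / 2)|).
rewrite min_l; last first.
  rewrite -lerBlDl -ler_pdivrMr ?divr_gt0//.
  by rewrite (le_trans (ler_norm _))// ltW// archi_boundP.
by rewrite (total_variationD f ax xb) fin_numD => /andP[].
Qed.

(** The increment of the variation function over an interval is the supremum
    of the variations over its partitions; choosing on each interval of a
    family a partition that is optimal up to e reduces the claim to
    partitioned families. *)
Lemma ac_TV f a b : a <= b -> ac f a b -> ac (fun x => fine (total_variation a x f)) a b.
Proof.
move=> ab acf eps eps0.
have e2 : 0 < eps / 2 by rewrite divr_gt0.
have [eta eta0 fm] := acf _ e2; exists eta => // n l r lr tlr slr.
have TVE i : fine (total_variation a (r i) f) - fine (total_variation a (l i) f) =
    fine (total_variation (l i) (r i) f) /\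
    total_variation (l i) (r i) f \is a fin_num.
  have [al [lri rb]] := lr i.
  have : total_variation a (r i) f \is a fin_num.
    by apply: (ac_TV_fin ab acf); rewrite rb (le_trans al).
  rewrite (total_variationD f al lri) fin_numD => /andP[h1 h2].
  by rewrite fineD// addrAC subrr add0r h2.
(* The choices made on the n intervals lose at most n e < eps / 2 in total. *)
pose e := eps / 2 / n.+1%:R.
have e0 : 0 < e by rewrite divr_gt0.
have /choice[s sP] : forall i, exists si, itv_partition (l i) (r i) si /\
    fine (total_variation (l i) (r i) f) <= variation (l i) (r i) f si + e.
  move=> i.
  have [_ fi] := TVE i.
  have [_ [_ [s ps <-] <-] h] := ub_ereal_sup_adherent e0 fi.
  exists s; split => //.
  move: h; rewrite -/(total_variation _ _ _) -(fineK fi) -EFinB lte_fin.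
  by rewrite ltrBlDr => /ltW.
have := ac_modulus_variation fm (fun i => conj (proj1 (lr i)) (proj2 (proj2 (lr i))))
  (fun i => proj1 (sP i)) tlr slr.
move=> h; rewrite (@le_lt_trans _ _ (\sum_(i < n) (variation (l i) (r i) f (s i) + e)))//.
  apply: ler_sum => i _; have [-> fi] := TVE i.
  rewrite ger0_norm; first exact: (proj2 (sP i)).
  by rewrite fine_ge0// total_variation_ge0//; case: (lr i) => _ [].
rewrite big_split/= sumr_const card_ord -[X in _ + X]mulr_natr.
have : e * n%:R < eps / 2.
  by rewrite /e -mulrA gtr_pMr// mulrC ltr_pdivrMr ?mul1r ?ltr_nat.
move: h; lra.
Qed.

Lemma acB f g a b : ac f a b -> ac g a b -> ac (fun x => f x - g x) a b.
Proof.
move=> acf acg eps eps0.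
have e2 : 0 < eps / 2 by rewrite divr_gt0.
have [e1 e10 fm] := acf _ e2; have [e3 e30 gm] := acg _ e2.
exists (Num.min e1 e3); first by rewrite lt_min e10.
move=> n l r lr tlr; rewrite lt_min => /andP[s1 s2].
rewrite [ltRHS]splitr; apply: le_lt_trans (ltrD (fm _ _ _ lr tlr s1) (gm _ _ _ lr tlr s2)).
rewrite -big_split/=; apply: ler_sum => i _.
by rewrite (_ : _ - _ - _ = (f (r i) - f (l i)) - (g (r i) - g (l i))) ?ler_normB//; ring.
Qed.

Lemma ac_near f a b : ac f a b -> forall eps, 0 < eps -> exists2 eta, 0 < eta &
  forall x y, a <= x <= b -> a <= y <= b -> `|x - y| < eta -> `|f x - f y| < eps.
Proof.
move=> acf eps eps0; have [eta eta0 fm] := acf _ eps0; exists eta => // x y.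
wlog xy : x y / x <= y.
  move=> H hx hy; have [xy|/ltW yx] := leP x y; first exact: H.
  by rewrite distrC [in X in _ -> X]distrC; apply: H.
move=> /andP[ax xb] /andP[ay yb].
rewrite (distrC x) (distrC (f x)) (@ger0_norm _ (y - x)) ?subr_ge0// => yx.
have := fm 1 (fun=> x) (fun=> y); rewrite !big_ord1 => h; apply: h => //.
by move=> i j _ _ _; rewrite !ord1.
Qed.

Lemma ac_bounded f a b : a <= b -> ac f a b ->
  exists2 M, 0 <= M & forall x, a <= x <= b -> `|f x| <= M.
Proof.
move=> ab acf; pose V x := fine (total_variation a x f).
exists (`|f a| + V b).
  by rewrite addr_ge0// /V fine_ge0// total_variation_ge0.
move=> x /andP[ax xb].
have fx : total_variation a x f \is a fin_num by apply: (ac_TV_fin ab acf); rewrite ax.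
have fb : total_variation a b f \is a fin_num by apply: (ac_TV_fin ab acf); rewrite ab lexx.
have h1 : `|f x - f a| <= V x by rewrite -lee_fin /V fineK// total_variation_ge.
have h2 : V x <= V b.
  by rewrite /V fine_le// (total_variationD f ax xb) leeDl// total_variation_ge0.
by have := ler_normD (f a) (f x - f a); rewrite addrC subrK; lra.
Qed.

(** Absolutely continuous functions on a segment are bounded, so the increment
    of the product is controlled by the increments of the factors. *)
Lemma acM f g a b : a <= b -> ac f a b -> ac g a b -> ac (fun x => f x * g x) a b.
Proof.
move=> ab acf acg eps eps0.
have [M M0 fM] := ac_bounded ab acf; have [K K0 gK] := ac_bounded ab acg.
have M1 : 0 < M + 1 by lra.
have K1 : 0 < K + 1 by lra.
have e1 : 0 < eps / 2 / (K + 1) by rewrite !divr_gt0.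
have e2 : 0 < eps / 2 / (M + 1) by rewrite !divr_gt0.
have [d1 d10 fm] := acf _ e1; have [d2 d20 gm] := acg _ e2.
exists (Num.min d1 d2); first by rewrite lt_min d10.
move=> n l r lr tlr; rewrite lt_min => /andP[s1 s2].
have := fm _ _ _ lr tlr s1; rewrite ltr_pdivlMr// => H1.
have := gm _ _ _ lr tlr s2; rewrite ltr_pdivlMr// => H2.
rewrite [ltRHS]splitr; apply: le_lt_trans (ltrD H1 H2).
rewrite 2!mulr_suml -big_split/=; apply: ler_sum => i _.
have [al [li rb]] := lr i.
have -> : f (r i) * g (r i) - f (l i) * g (l i) =
  (f (r i) - f (l i)) * g (r i) + f (l i) * (g (r i) - g (l i)) by ring.
apply: (le_trans (ler_normD _ _)); rewrite !normrM; apply: lerD.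
  rewrite ler_wpM2l// (le_trans (gK _ _)) ?lerDl//.
  by rewrite rb (le_trans al).
rewrite mulrC ler_wpM2l// (le_trans (fM _ _)) ?lerDl//.
by rewrite al (le_trans li).
Qed.

Lemma continuous_bounded f a b : a <= b -> continuous f ->
  exists2 M, 0 <= M & forall x, a <= x <= b -> `|f x| <= M.
Proof.
move=> ab cf.
have [|c _ Mc] := @EVT_max R (fun x => `|f x|) a b ab.
  by apply: continuous_subspaceT => x; exact: cvg_norm (cf x).
by exists `|f c| => // x xab; apply: Mc; rewrite in_itv.
Qed.

Lemma Ck_fun_ac f a b : a <= b -> Ck_fun 1 f -> ac f a b.
Proof.
move=> ab cf; have fd := Ck_fun_derive cf.
have [M M0 fM] : exists2 M, 0 <= M & forall x, a <= x <= b -> `|derive1 f x| <= M.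
  by apply: continuous_bounded => //; have /Ck_funS[_ /Ck_fun0] := cf.
have lip x y : a <= x -> x <= y -> y <= b -> `|f y - f x| <= M * (y - x).
  move=> ax xy yb.
  have cw : {within `[x, y], continuous f}.
    by apply: continuous_subspaceT; exact: is_derive_continuous fd.
  have [c] := MVT_segment xy (fun z _ => fd z) cw.
  rewrite in_itv/= => /andP[xc cy] ->.
  rewrite normrM (@ger0_norm _ (y - x)) ?subr_ge0// ler_wpM2r ?subr_ge0//.
  by apply: fM; rewrite (le_trans ax) ?(le_trans cy).
move=> eps eps0; have M1 : 0 < M + 1 by lra.
exists (eps / (M + 1)); first by rewrite divr_gt0.
move=> n l r lr _; rewrite ltr_pdivlMr// => slr.
apply: le_lt_trans slr; rewrite mulr_suml; apply: ler_sum => i _.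
have [al [li rb]] := lr i.
rewrite (le_trans (lip _ _ al li rb))// mulrC ler_wpM2l ?subr_ge0//; lra.
Qed.

End absolute_continuity.

(** * The Stieltjes measure of a monotone absolutely continuous function *)

Section stieltjes.
Variable R : realType.
Implicit Types (f g F : R -> R) (a b : R).
Local Notation mu := (@lebesgue_measure R).

(** For a <= b this is the point of [a, b] nearest to x. Composing with it
    extends a function from [a, b] to the line by constants. *)
Definition clamp a b x : R := Num.max a (Num.min b x).

Lemma clamp_homo a b : {homo clamp a b : x y / x <= y}.
Proof.
move=> x y xy; rewrite /clamp /Num.max /Num.min.
by case: ifP; case: ifP; case: ifP; case: ifP; lra.
Qed.

Lemma clamp_in a b x : a <= b -> a <= clamp a b x <= b.
Proof.
by rewrite /clamp /Num.max /Num.min; case: ifP; case: ifP; lra.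
Qed.

Lemma clamp_id a b x : a <= x <= b -> clamp a b x = x.
Proof. by rewrite /clamp /Num.max /Num.min; case: ifP; case: ifP; lra. Qed.

Lemma clamp_dist a b x y : a <= b -> x <= y ->
  clamp a b y - clamp a b x <= y - x.
Proof.
by rewrite /clamp /Num.max /Num.min; case: ifP; case: ifP; case: ifP; case: ifP; lra.
Qed.

Lemma clamp_lipschitz a b x y : a <= b ->
  `|clamp a b x - clamp a b y| <= `|x - y|.
Proof.
move=> ab; wlog xy : x y / x <= y.
  move=> H; have [/H//|/ltW /H] := leP x y.
  by rewrite distrC (distrC x).
rewrite distrC (distrC x) !ger0_norm ?subr_ge0 ?clamp_homo//.
exact: clamp_dist.
Qed.

Lemma clamp_itv a b x y : a <= b ->
  `]clamp a b x, clamp a b y[%classic `<=` `]x, y[%classic.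
Proof.
move=> ab z; rewrite /= !in_itv/= /clamp /Num.max /Num.min.
by case: ifP; case: ifP; case: ifP; case: ifP; lra.
Qed.

(** The decomposition of an open set into disjoint open intervals, with the
    end points made explicit; an empty component is written as the interval
    ]c, c[. *)
Lemma open_itv_seq (U : set R) c d : open U -> c <= d -> U `<=` `]c, d[%classic ->
  exists l r : nat -> R, [/\ forall k, l k <= r k,
    trivIset setT (fun k => `]l k, r k[%classic) &
    U = \bigcup_k `]l k, r k[%classic].
Proof.
move=> oU cd Ucd.
pose I := open_disjoint_itv oU.
have IE k : exists lr : R * R, lr.1 <= lr.2 /\ I k = `]lr.1, lr.2[%classic.
  have [->|/set0P I0] := eqVneq (I k) set0.
    by exists (c, c); split => //=; rewrite set_itvoo0.
  have IU : I k `<=` `]c, d[%classic.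
    by apply: subset_trans Ucd; rewrite [X in _ `<=` X](open_disjoint_itv_bigcup oU) => x Ix; exists k.
  have lb : has_lbound (I k).
    by exists c => x /IU; rewrite /= in_itv/= => /andP[/ltW].
  have ub : has_ubound (I k).
    by exists d => x /IU; rewrite /= in_itv/= => /andP[_ /ltW].
  exists (inf (I k), sup (I k)); split => /=.
    have [x Ix] := I0; apply: (@le_trans _ _ x).
      exact: ge_inf.
    exact: ub_le_sup.
  have := interval_bounded_interior (@open_disjoint_itv_is_interval _ _ oU k) lb ub.
  rewrite (interior_id (I k)).1; last exact: open_disjoint_itv_open.
  by move=> {1}->; apply/seteqP; split=> x; rewrite /= in_itv.
have [lr lrP] := choice IE.
exists (fun k => (lr k).1), (fun k => (lr k).2); split.
- by move=> k; have [] := lrP k.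
- rewrite [X in trivIset _ X](_ : _ = I); first exact: open_disjoint_itv_trivIset.
  by apply/funext => k; have [] := lrP k.
- rewrite [LHS](open_disjoint_itv_bigcup oU); apply: eq_bigcupr => k _.
  by have [] := lrP k.
Qed.

Section clamped.
Variables (a b : R) (F : R -> R).
Hypothesis ab : a <= b.
Hypothesis ndF : {in `[a, b] &, {homo F : x y / x <= y}}.
Hypothesis acF : ac F a b.

(** A Stieltjes measure needs a nondecreasing right-continuous function on the
    whole line, hence the extension by constants. *)
Definition clamped x := F (clamp a b x).

Let clamp_mem x : clamp a b x \in `[a, b].
Proof. by rewrite in_itv/= clamp_in. Qed.

Lemma clamped_nd : nondecreasing clamped.
Proof. by move=> x y xy; apply: ndF => //; exact: clamp_homo. Qed.

Lemma clamped_continuous : continuous clamped.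
Proof.
move=> x; apply/cvgrPdist_lt => eps eps0.
have [eta eta0 h] := ac_near acF eps0.
near=> y; apply: h; rewrite ?clamp_in//.
apply: le_lt_trans (clamp_lipschitz x y ab) _.
by near: y; exact: cvgr_dist_lt.
Unshelve. all: by end_near. Qed.

Lemma clamped_rc : right_continuous clamped.
Proof. exact/right_continuousW/clamped_continuous. Qed.

HB.instance Definition _ := isCumulative.Build R _ R clamped clamped_nd clamped_rc.

Let nu : {measure set (measurableTypeR R) -> \bar R} := lebesgue_stieltjes_measure clamped.

Lemma stieltjes_itvoc x y : x <= y -> nu `]x, y]%classic = (clamped y - clamped x)%:E.
Proof.
move=> xy; rewrite -[LHS]/(lebesgue_stieltjes_measure clamped `]x, y]%classic).
rewrite /lebesgue_stieltjes_measure /= /measure_extension /=.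
rewrite measurable_mu_extE//=; last exact: is_ocitv.
by rewrite wlength_itv_bnd.
Qed.



(** The null set is contained in an open set of small measure, which is a
    union of disjoint intervals; the total increment of F over finitely many
    of them is small by absolute continuity, uniformly in their number. *)
Lemma stieltjes_dominated (N : set (measurableTypeR R)) : measurable N ->
  mu N = 0%E -> nu (N `&` `]a, b]%classic) = 0%E.
Proof.
move=> mN N0.
have mI : measurable (N `&` `]a, b]%classic : set (measurableTypeR R)).
  by apply: measurableI => //; exact: measurable_itv.
apply/eqP; rewrite eq_le measure_ge0 andbT.
apply/lee_addgt0Pr => eps eps0; rewrite add0e.
have [eta eta0 Fm] := acF eps0.
have NI0 : mu (N `&` `]a, b]%classic) = 0%E.
  by apply/eqP; rewrite eq_le measure_ge0 andbT -N0 le_measure ?inE//; exact: subIsetl.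
have [U0 [oU0 NU0 U0eta]] : exists U, [/\ open U, N `&` `]a, b]%classic `<=` U &
    (mu (U `\` (N `&` `]a, b]%classic)) < eta%:E)%E].
  have NIy : (mu (N `&` `]a, b]%classic) < +oo)%E by rewrite NI0 ltry.
  exact: lebesgue_regularity_outer.
(* The intersection makes the components of U bounded, and keeps the point b,
   which may belong to N. *)
pose U := U0 `&` `]a - 1, b + 1[%classic.
have oU : open U by apply: openI => //; exact: interval_open.
have NU : N `&` `]a, b]%classic `<=` U.
  move=> x Nx; split; first exact: NU0.
  by case: Nx => _; rewrite /= !in_itv/= => /andP[ax xb]; apply/andP; split; lra.
have mU : measurable (U : set (measurableTypeR R)) by exact: open_measurable.
have Ueta : (mu U < eta%:E)%E.
  apply: le_lt_trans U0eta.
  rewrite -[leRHS]adde0 -NI0 -measureU//.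
  - rewrite setUC setDUK//; apply: le_measure; rewrite ?inE//; [exact: open_measurable|exact: subIsetl].
  - by apply: measurableD => //; exact: open_measurable.
  - by rewrite setIC setDIK.
have ab1 : a - 1 <= b + 1 by rewrite (le_trans _ (le_trans ab _)) ?gerBl ?lerDl.
have [l [r [lr tlr UE]]] := open_itv_seq oU ab1 (@subIsetr _ _ _).
rewrite (@le_trans _ _ (nu U))//; first by rewrite le_measure ?inE.
rewrite UE measure_semi_bigcup//; last by rewrite -UE.
apply: lime_le; first by apply: is_cvg_nneseries => *; exact: measure_ge0.
apply: nearW => K.
rewrite (@le_trans _ _ (\sum_(0 <= k < K) (clamped (r k) - clamped (l k))%:E)%E)//.
  apply: lee_sum => k _; rewrite -stieltjes_itvoc// le_measure ?inE//.
  exact: subset_itv_oo_oc.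
rewrite sumEFin lee_fin big_mkord.
apply/ltW/(@le_lt_trans _ _ (\sum_(k < K) `|F (clamp a b (r k)) - F (clamp a b (l k))|)).
  by apply: ler_sum => i _; exact: ler_norm.
apply: Fm.
- move=> i; have /andP[-> _] := clamp_in (l i) ab; have /andP[_ ->] := clamp_in (r i) ab.
  by rewrite clamp_homo.
- move=> i j _ _ [x [xi xj]]; apply/val_inj/tlr => //; exists x; split;
  exact: (clamp_itv ab _).
- apply: (@le_lt_trans _ _ (\sum_(i < K) (r i - l i))).
    by apply: ler_sum => i _; exact: clamp_dist.
  rewrite -lte_fin; apply: le_lt_trans Ueta.
  rewrite UE measure_semi_bigcup//; last by rewrite -UE.
  apply: le_trans (nneseries_lim_ge K _); last by move=> *; exact: measure_ge0.
  rewrite -(big_mkord xpredT (fun i => r i - l i)) -sumEFin.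
  apply: lee_sum => i _; rewrite [leRHS](lebesgue_measure_itv `]l i, r i[)/= lte_fin.
  by case: ltP => // rl; rewrite lee_fin subr_le0.
Qed.

(** The density is the Radon-Nikodym derivative of the Stieltjes measure. *)
Lemma nondecreasing_ac_density : exists g : R -> R,
  mu.-integrable [set: measurableTypeR R] (EFin \o g) /\
  forall x, a <= x <= b -> F x - F a = \int[mu]_(t in `]a, x]) g t.
Proof.
have mab : measurable (`]a, b]%classic : set (measurableTypeR R)) by [].
have nuy : (nu `]a, b]%classic < +oo)%E by rewrite stieltjes_itvoc// ltry.
have dom : mfrestr mab nuy `<< mu.
  by apply/null_content_dominatesP => N mN N0; exact: stieltjes_dominated.
have [g [_ gfin gint gE]] := radon_nikodym_sigma_finite dom.
exists (fine \o g); split.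
  apply: eq_integrable gint => // x _ /=; by rewrite fineK.
move=> x /andP[ax xb].
rewrite /Rintegral (eq_integral g); last by move=> t _ /=; rewrite fineK.
transitivity (fine (nu (`]a, x]%classic `&` `]a, b]%classic))); last by rewrite -gE.
rewrite setIidl; last exact: subset_itvl.
rewrite stieltjes_itvoc//= /clamped !clamp_id ?lexx ?ab//.
by rewrite ax xb.
Qed.

End clamped.
End stieltjes.

(** * The fundamental theorem of calculus for absolutely continuous functions *)

Section fundamental_theorem.
Variable R : realType.
Implicit Types (f g h G : R -> R) (a b : R).
Local Notation mu := (@lebesgue_measure R).

(** V and V - f are nondecreasing and absolutely continuous, where V is the
    variation function of f. *)
Lemma ac_density f a b : a < b -> ac f a b -> exists g : R -> R,
  mu.-integrable [set: measurableTypeR R] (EFin \o g) /\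
  forall x, a <= x <= b -> f x - f a = \int[mu]_(t in `]a, x]) g t.
Proof.
move=> ab acf; have leab := ltW ab.
pose V x := fine (total_variation a x f).
have acV : ac V a b by exact: ac_TV.
have TVB x y : a <= x -> x <= y -> y <= b ->
    V y - V x = fine (total_variation x y f) /\ total_variation x y f \is a fin_num.
  move=> ax xy yb.
  have : total_variation a y f \is a fin_num by apply: (ac_TV_fin leab acf); rewrite yb (le_trans ax).
  rewrite /V (total_variationD f ax xy) fin_numD => /andP[h1 h2].
  by rewrite fineD// addrAC subrr add0r h2.
have ndV : {in `[a, b] &, {homo V : x y / x <= y}}.
  move=> x y; rewrite !in_itv/= => /andP[ax xb] /andP[ay yb] xy.
  rewrite -subr_ge0; have [-> _] := TVB _ _ ax xy yb.
  by rewrite fine_ge0// total_variation_ge0.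
have ndVf : {in `[a, b] &, {homo (fun x => V x - f x) : x y / x <= y}}.
  move=> x y; rewrite !in_itv/= => /andP[ax xb] /andP[ay yb] xy.
  have [VE Vf] := TVB _ _ ax xy yb.
  have := total_variation_ge f xy; rewrite -(fineK Vf) lee_fin -VE.
  by move/(le_trans (ler_norm _)); lra.
have [g1 [ig1 g1E]] := nondecreasing_ac_density leab ndV acV.
have [g2 [ig2 g2E]] := nondecreasing_ac_density leab ndVf (acB acV acf).
exists (fun x => g1 x - g2 x); split.
  exact: (integrableB measurableT ig1 ig2).
move=> x axb.
have iS g : mu.-integrable [set: measurableTypeR R] (EFin \o g) ->
    mu.-integrable (`]a, x]%classic : set (measurableTypeR R)) (EFin \o g).
  by move=> ig; exact: integrableS ig.
rewrite RintegralB//; [|exact: iS..].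
by rewrite -g1E// -g2E//; ring.
Qed.

(** Almost everywhere differentiability cannot be taken for granted here,
    since the total derivative has an arbitrary value where the limit does not
    exist; it comes from the Lebesgue differentiation theorem applied to the
    density. *)
Lemma ac_FTC f a b : a < b -> ac f a b -> exists g : R -> R,
  [/\ mu.-integrable [set: measurableTypeR R] (EFin \o g),
      forall x, a <= x <= b -> f x - f a = \int[mu]_(t in `]a, x]) g t &
      {ae mu, forall x, a < x < b -> derivable f x 1 /\ derive1 f x = g x}].
Proof.
move=> ab acf; have [g [ig gE]] := ac_density ab acf; exists g; split => //.
have lg : locally_integrable [set: R] g.
  apply: open_integrable_locally; [exact: openT|exact: ig].
have ig' y : mu.-integrable [set` Interval (BRight a) (BRight y)] (EFin \o g).
  exact: integrableS ig.
have [J JE] : exists J : R -> R, J = (fun y => \int[mu]_(t in `]a, y]) g t) by eexists.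
have gE' y : a <= y <= b -> f y - f a = J y by rewrite JE; exact: gE.
have := FTC1 ig' lg; cbv zeta; rewrite -JE; clear JE.
apply: filterS; first exact: (ae_filter_ringOfSetsType mu).
move=> x /= H /andP[ax xb].
have [dF F'] := H ax.
have near_eq : \forall y \near x, (cst (f a) + J) y = f y.
  near=> y; rewrite -[LHS]/(f a + J y) -gE'; first by rewrite addrC subrK.
  have : y \in `]a, b[ by near: y; apply: near_in_itvoo; rewrite in_itv/= ax.
  by rewrite in_itv/= => /andP[/ltW -> /ltW].
have dJ : is_derive x 1 J (g x) by apply: DeriveDef; [exact: dF|rewrite -derive1E].
have [dF2 DF2] := is_deriveD (is_derive_cst (f a) x 1) dJ.
split; first exact: near_eq_derivable near_eq dF2.
by rewrite derive1E -(near_eq_derive _ near_eq) DF2 add0r.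
Unshelve. all: by end_near. Qed.

(** Both sides are integrals over ]a, x]: of the density of f on the left, of
    h on the right; the two integrands agree almost everywhere. *)
Lemma ac_derive1_eq f h G a b : a < b -> ac f a b ->
    (forall x, is_derive x (1:R) G (h x)) -> continuous h ->
    {ae mu, forall x, a < x < b -> derive1 f x = h x} ->
  forall x, a <= x <= b -> f x - f a = G x - G a.
Proof.
move=> ab acf GE ch fh.
have [g [ig gE dg]] := ac_FTC ab acf.
move=> x /andP[]; rewrite le_eqVlt => /predU1P[<-|ax] xb; first by rewrite !subrr.
rewrite gE ?(ltW ax)//.
have mg : measurable_fun (`]a, x]%classic : set (measurableTypeR R)) (EFin \o g).
  by apply: measurable_funTS; apply: (measurable_int mu).
have mh (I : interval R) : measurable_fun [set` I] (EFin \o h).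
  apply/measurable_EFinP; apply: measurable_funTS.
  exact: continuous_measurable_fun.
transitivity (fine (\int[mu]_(t in `]a, x]) (h t)%:E)%E).
  rewrite /Rintegral; congr fine; apply: ae_eq_integral => //; first exact: mh.
  (* The derivative of f is controlled on the open interval only. *)
  have b0 : mu.-negligible [set b]
    by exists [set b]; split => //; exact: lebesgue_measure_set1.
  have nb : {ae mu, forall t, t <> b} by apply: negligibleS b0 => t /= /contrapT.
  move: nb fh dg; apply: filterS3; first exact: (ae_filter_ringOfSetsType mu).
  move=> t /= tb fh dg; rewrite in_itv/= => /andP[at' tx].
  have atb : a < t < b.
    by rewrite at' /= lt_neqAle (le_trans tx xb) andbT; exact/eqP.
  by have [_ <-] := dg atb; rewrite fh.
rewrite integral_itv_obnd_cbnd; last exact: mh.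
rewrite (continuous_FTC2 ax (F := G)) //.
- exact: continuous_subspaceT.
- have cG : continuous G.
    by move=> y; apply/differentiable_continuous/derivable1_diffP; case: (GE y).
  split; first by move=> y _; case: (GE y).
  + exact/cvg_at_right_filter/cG.
  + exact/cvg_at_left_filter/cG.
- by move=> y _; rewrite derive1E; case: (GE y).
Qed.

End fundamental_theorem.

(** * Functions and diffeomorphisms of the circle *)

Section circle_functions.
Variable R : realType.
Implicit Types (f g h : R -> R) (t : R) (u v : circle R -> R[i]).
Local Notation mu := (@lebesgue_measure R).
Local Notation T := (pi *+ 2 : R).

Lemma two_pi_gt0 : 0 < T.
Proof. by rewrite pmulrn_lgt0// pi_gt0. Qed.

Lemma expi_surj (z : circle R) : exists t, expi t = z.
Proof.
case: z => -[x y] h; have := h; rewrite /= => /eqP xy1.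
have xy : x ^+ 2 + y ^+ 2 = 1.
  by rewrite -[LHS]sqr_sqrtr ?addr_ge0 ?sqr_ge0// xy1 expr1n.
by have [t [ct st]] := angle_exists xy; exists t; apply/val_inj; rewrite /= ct st.
Qed.

Lemma expiD2pi t : expi (t + T) = expi t.
Proof. by apply/val_inj; rewrite /= cosD2pi sinD2pi. Qed.

Lemma rot_expi s t : Defs.rot s (expi t) = expi (s + t).
Proof.
apply/val_inj; rewrite /= cosD sinD; apply/eqP; rewrite eq_complex /= eqxx /=.
by apply/eqP; ring.
Qed.

Lemma cval_neq0 (z : circle R) : cval z != 0.
Proof.
apply/eqP => z0; have := cvalP z; rewrite z0 /= expr0n /= addr0 sqrtr0.
by rewrite eq_sym oner_eq0.
Qed.

(** Holds without differentiability: the difference quotients on both sides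
    are the same functions. *)
Lemma derive1_shift f t : derive1 (fun s => f (s + t)) 0 = derive1 f t.
Proof. by rewrite /derive1; under eq_fun do rewrite addr0 add0r. Qed.

Lemma dtheta_expi u t : dtheta u (expi t) = cderive (fun s => u (expi s)) t.
Proof.
rewrite /dtheta /cderive.
rewrite -(derive1_shift (fun s => complex.Re (u (expi s)))).
rewrite -(derive1_shift (fun s => complex.Im (u (expi s)))).
by congr (derive1 _ 0 +i* derive1 _ 0); apply/funext => s; rewrite rot_expi.
Qed.

Lemma izdz u z : 'i * cval z * dz u z = dtheta u z.
Proof. by rewrite /dz mulrA mulfV ?mul1r// mulf_neq0 ?neq0Ci ?cval_neq0. Qed.

Lemma periodic_int (A : zmodType) (g : R -> A) : periodic g T ->
  forall (k : int) t, g (t + T *~ k) = g t.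
Proof.
move=> gT [] k t; first exact: periodicn.
rewrite NegzE mulrNz.
by have := periodicn gT k.+1 (t - T *+ k.+1); rewrite subrK => ->.
Qed.

Lemma periodic_reduce t : exists2 s, 0 <= s < T & exists k : int, t = s + T *~ k.
Proof.
pose k := Num.floor (t / T); exists (t - T *~ k); last by exists k; rewrite subrK.
have kt : k%:~R <= t / T < (k + 1)%:~R by rewrite floor_itv ?num_real.
move: kt; rewrite ler_pdivlMr ?two_pi_gt0// ltr_pdivrMr ?two_pi_gt0// => /andP[k1 k2].
rewrite subr_ge0 -mulrzl k1 /= ltrBlDl.
by move: k2; rewrite intrD mulrDl mul1r.
Qed.

(** After reduction of r = s - t to [0, 2 pi[, cos r = 1 gives sin (r / 2) =
    0, and r / 2 lies in [0, pi[, where the sine vanishes only at 0. *)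
Lemma expi_inj_mod s t : expi s = expi t -> exists k : int, s = t + T *~ k.
Proof.
move=> /(congr1 (@cval R)) [cst sst].
have [r /andP[r0 rT] [k rE]] := periodic_reduce (s - t).
exists k; apply/eqP; rewrite -subr_eq0; apply/eqP.
suff r00 : r = 0 by rewrite opprD addrA rE r00; ring.
have cr : cos r = 1.
  have : cos (s - t) = 1.
    by rewrite cosB cst sst -!expr2 cos2Dsin2.
  rewrite rE; suff -> : cos (r + T *~ k) = cos r by [].
  exact: (periodic_int (@cosD2pi R)).
have : cos (r / 2 *+ 2) = 1 by rewrite -mulr_natr divfK ?pnatr_eq0.
rewrite cos_mulr2n cos2sin2 => h.
have /eqP s0 : sin (r / 2) ^+ 2 = 0 by move: h; lra.
rewrite sqrf_eq0 in s0; move: r0; rewrite le_eqVlt => /predU1P[//|r0].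
have : 0 < sin (r / 2).
  apply: sin_gt0_pi; rewrite divr_gt0//= ltr_pdivrMr//.
  by rewrite mulr_natr.
by rewrite (eqP s0) ltxx.
Qed.

Lemma periodic_descend (A : zmodType) (g : R -> A) : periodic g T ->
  exists u : circle R -> A, forall t, u (expi t) = g t.
Proof.
move=> gT.
have [arg argK] := choice expi_surj.
exists (fun z => g (arg z)) => t.
have [k ->] := expi_inj_mod (argK (expi t)).
exact: periodic_int.
Qed.

Lemma circle_lift (c : circle R -> circle R) :
    cCinfty (fun t => cval (c (expi t))) ->
  exists F, smooth F /\ forall t, c (expi t) = expi (F t).
Proof.
move=> cc.
have sr : smooth (fun t => complex.Re (cval (c (expi t)))) by move=> k; case: (cc k).
have si : smooth (fun t => complex.Im (cval (c (expi t)))) by move=> k; case: (cc k).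
have [F [sF FE]] : exists F, smooth F /\ forall t,
    cos (F t) = complex.Re (cval (c (expi t))) /\ sin (F t) = complex.Im (cval (c (expi t))).
  apply: smooth_lift => // t; case: (c (expi t)) => -[x y] /= /eqP xy1.
  by rewrite -[LHS]sqr_sqrtr ?addr_ge0 ?sqr_ge0// xy1 expr1n.
exists F; split=> // t; apply/val_inj => /=.
by have [-> ->] := FE t; case: (cval _).
Qed.

Lemma iter_expi (c : circle R -> circle R) f k t :
  (forall t, c (expi t) = expi (f t)) -> iter k c (expi t) = expi (iter k f t).
Proof. by move=> cf; elim: k => //= k ->; rewrite cf. Qed.

Lemma iter_cancel (X : Type) (c d : X -> X) k :
  cancel c d -> cancel (iter k c) (iter k d).
Proof. by move=> cd; elim: k => // k ih x; rewrite iterSr /= cd ih. Qed.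

(** The lift G of the inverse is carried along because the relation between F
    and G forces the derivative of F to have no zero. *)
Lemma citer_lift (c : circle_diffeo R) (n : int) : exists F G,
  [/\ smooth F, smooth G, forall t, citer c n (expi t) = expi (F t) &
      forall t, expi (G (F t)) = expi t].
Proof.
have [F [sF FE]] := circle_lift (@cdiff_smooth R c).
have [G [sG GE]] := circle_lift (@cdiffV_smooth R c).
case: n => k.
- exists (iter k F), (iter k G); split; [exact: smooth_iter|exact: smooth_iter| |].
    by move=> t; exact: iter_expi.
  move=> t; rewrite -(iter_expi _ _ GE) -(iter_expi _ _ FE).
  exact/iter_cancel/cdiffK.
- exists (iter k.+1 G), (iter k.+1 F); split; [exact: smooth_iter|exact: smooth_iter| |].
    by move=> t; exact: iter_expi.
  move=> t; rewrite -(iter_expi _ _ FE) -(iter_expi _ _ GE).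
  exact/iter_cancel/cdiffVK.
Qed.

Lemma is_derive_cis F t dF : is_derive t (1:R) F dF ->
  is_derive t (1:R) (fun s => cos (F s)) (- sin (F t) * dF) /\
  is_derive t (1:R) (fun s => sin (F s)) (cos (F t) * dF).
Proof.
move=> Fd; split.
- exact: (is_derive1_comp (is_derive_cos (F t)) Fd).
- exact: (is_derive1_comp (is_derive_sin (F t)) Fd).
Qed.

(** The function d is the derivative of the lift F of the iterate:
    differentiating exp (i F) turns delta into F'. It has no zero since exp (i
    G (F t)) = exp (i t) gives (G o F)' = 1. *)
Lemma deltaE (c : circle_diffeo R) (n : int) : exists d : R -> R,
  [/\ smooth d, forall t, d t != 0 & forall t, delta c n (expi t) = (d t)%:C].
Proof.
have [F [G [sF sG FE GFE]]] := citer_lift c n.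
have dF := smooth_derive sF; have dG := smooth_derive sG.
exists (derive1 F); split; first exact: smooth_derive1.
- move=> t; apply/eqP => F0.
  have dK : is_derive t (1:R) (fun s => G (F s)) 0.
    by apply: (is_derive_eq (is_derive1_comp (dG (F t)) (dF t))); rewrite F0 mulr0.
  have [dc ds] := is_derive_cis dK.
  have cE : (fun s => cos (G (F s))) = cos.
    by apply/funext => s; have /(congr1 (@cval R)) [] := GFE s.
  have sE : (fun s => sin (G (F s))) = sin.
    by apply/funext => s; have /(congr1 (@cval R)) [] := GFE s.
  rewrite cE mulr0 in dc; rewrite sE mulr0 in ds.
  have c0 : cos t = 0 by rewrite -(derive1_val ds) (derive1_val (is_derive_sin t)).
  have s0 : sin t = 0.
    by apply/eqP; rewrite -oppr_eq0 -(derive1_val (is_derive_cos t)) (derive1_val dc).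
  by have := cos2Dsin2 t; rewrite c0 s0 expr0n addr0 => /eqP; rewrite eq_sym oner_eq0.
- move=> t; rewrite /delta /dz dtheta_expi FE.
  have -> : cderive (fun s => cval (citer c n (expi s))) t =
      'i * cval (expi (F t)) * (derive1 F t)%:C.
    have -> : (fun s => cval (citer c n (expi s))) = (fun s => cval (expi (F s))).
      by apply/funext => s; rewrite FE.
    have [dc ds] := is_derive_cis (dF t).
    rewrite /cderive /= (derive1_val dc) (derive1_val ds) -complexiE.
    by apply/eqP; rewrite eq_complex /=; apply/andP; split; apply/eqP; ring.
  have z0 := cval_neq0 (expi t); have w0 := cval_neq0 (expi (F t)).
  have i0 : 'i != 0 :> R[i] by exact: neq0Ci.
  move: (cval (expi t)) (cval (expi (F t))) z0 w0 ((derive1 F t)%:C) => z w z0 w0 x.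
  by field; rewrite ?z0 ?w0 ?i0.
Qed.

End circle_functions.

(** * Measure and function spaces on the circle *)

Section circle_analysis.
Variable R : realType.
Implicit Types (f g h : R -> R) (t : R) (u v : circle R -> R[i]).
Local Notation mu := (@lebesgue_measure R).
Local Notation T := (pi *+ 2 : R).

Lemma circle_ae_expi u v : circle_ae_eq u v ->
  {ae mu, forall t, 0 < t < T -> u (expi t) = v (expi t)}.
Proof.
move=> [N [mN N0 uvN]].
exists (@expi R @^-1` N `&` `[0, T[%classic); split.
- by apply: measurableI => //; rewrite -[X in measurable X]setTI; exact: measurable_expi.
- move: N0; rewrite /circle_measure /pushforward /angle_measure /= /mscale /= /mrestr.
  by move/eqP; rewrite mule_eq0 eqe invr_eq0 gt_eqF ?two_pi_gt0//= => /eqP.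
- move=> t /= /not_implyP [/andP[t0 tT] uv]; split.
    by apply: uvN => /= uv'; apply: uv; exact: uv'.
  by rewrite in_itv/= (ltW t0).
Qed.

Lemma Re_le_normc (z : R[i]) : `|complex.Re z| <= normc z.
Proof.
case: z => x y /=; rewrite -sqrtr_sqr ler_sqrt ?addr_ge0 ?sqr_ge0//.
by rewrite lerDl sqr_ge0.
Qed.

Lemma Im_le_normc (z : R[i]) : `|complex.Im z| <= normc z.
Proof.
case: z => x y /=; rewrite -sqrtr_sqr ler_sqrt ?addr_ge0 ?sqr_ge0//.
by rewrite lerDr sqr_ge0.
Qed.

Lemma normc_le_ReIm (z : R[i]) : normc z <= `|complex.Re z| + `|complex.Im z|.
Proof.
case: z => x y /=.
rewrite -[leRHS]ger0_norm ?addr_ge0// -sqrtr_sqr ler_sqrt ?sqr_ge0//.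
rewrite sqrrD !real_normK ?num_real// -addrA lerD2l lerDr.
by rewrite mulrn_wge0// mulr_ge0.
Qed.

Lemma abs_cont_ac a b (w : R -> R[i]) : abs_cont a b w ->
  ac (fun t => complex.Re (w t)) a b /\ ac (fun t => complex.Im (w t)) a b.
Proof.
move=> acw; split=> eps eps0; have [eta eta0 wm] := acw _ eps0;
  exists eta => // n l r lr tlr slr; apply: le_lt_trans (wm n l r lr tlr slr);
  apply: ler_sum => i _.
- by apply: le_trans (Re_le_normc _); case: (w (r i)) (w (l i)) => [? ?] [].
- by apply: le_trans (Im_le_normc _); case: (w (r i)) (w (l i)) => [? ?] [].
Qed.

Lemma ac_abs_cont a b (w : R -> R[i]) :
  ac (fun t => complex.Re (w t)) a b -> ac (fun t => complex.Im (w t)) a b ->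
  abs_cont a b w.
Proof.
move=> acr aci eps eps0; have e2 : 0 < eps / 2 by rewrite divr_gt0.
have [e1 e10 fm] := acr _ e2; have [e3 e30 gm] := aci _ e2.
exists (Num.min e1 e3); first by rewrite lt_min e10.
move=> n l r lr tlr; rewrite lt_min => /andP[s1 s2].
rewrite [ltRHS]splitr; apply: le_lt_trans (ltrD (fm _ _ _ lr tlr s1) (gm _ _ _ lr tlr s2)).
rewrite -big_split/=; apply: ler_sum => i _.
by apply: le_trans (normc_le_ReIm _) _; case: (w (r i)) (w (l i)) => [? ?] [].
Qed.

Lemma circle_measurable_fun (f : circle R -> R) :
  continuous (fun t => f (expi t)) -> measurable_fun [set: circle R] f.
Proof.
move=> cf _ Y mY; rewrite setTI.
have mf : measurable_fun [set: R] (fun t => f (expi t)) by exact: continuous_measurable_fun.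
exact: (mf measurableT Y mY).
Qed.

Lemma circle_measure_fin : (@circle_measure R setT < +oo)%E.
Proof.
rewrite /circle_measure /pushforward /angle_measure /= /mscale /= /mrestr preimage_setT setTI.
rewrite lebesgue_measure_itv/= lte_fin two_pi_gt0/= -EFinD -EFinM; exact: ltry.
Qed.

(** By periodicity u is bounded by its maximum over one period, and the
    measure of the circle is finite. *)
Lemma normL2sq_fin u : continuous (fun t => complex.Re (u (expi t))) ->
  continuous (fun t => complex.Im (u (expi t))) -> (normL2sq u < +oo)%E.
Proof.
move=> cr ci; have T0 := two_pi_gt0 R.
have [M M0 rM] := continuous_bounded (ltW T0) cr.
have [K K0 iK] := continuous_bounded (ltW T0) ci.
have ub z : normc (u z) ^+ 2 <= (M + K) ^+ 2.
  have [t <-] := expi_surj z.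
  have [s /andP[s0 sT] [k ->]] := periodic_reduce t.
  have pn : periodic (fun x => normc (u (expi x))) T by move=> x; rewrite expiD2pi.
  rewrite (periodic_int pn).
  have sT' : 0 <= s <= T by rewrite s0 ltW.
  have n0 : 0 <= normc (u (expi s)) by apply: le_trans (Re_le_normc _).
  rewrite ler_pXn2r ?nnegrE ?addr_ge0//.
  by apply: le_trans (normc_le_ReIm _) _; apply: lerD; [exact: rM|exact: iK].
have mr := @circle_measurable_fun (fun z => complex.Re (u z)) cr.
have mi := @circle_measurable_fun (fun z => complex.Im (u z)) ci.
apply: (@le_lt_trans _ _ (\int[@circle_measure R]_z ((M + K) ^+ 2)%:E)%E).
  apply: ge0_le_integral => //.
  - by move=> z _; rewrite lee_fin sqr_ge0.
  - apply/measurable_EFinP.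
    rewrite (_ : (fun z => _) = (fun z => complex.Re (u z) ^+ 2 + complex.Im (u z) ^+ 2)).
      by apply: measurable_funD; exact: measurable_funX.
    apply/funext => z; case: (u z) => x y /=.
    by rewrite sqr_sqrtr// addr_ge0// sqr_ge0.
  - by move=> z _; rewrite lee_fin.
rewrite integral_cst// lte_mul_pinfty ?lee_fin ?sqr_ge0//.
exact: circle_measure_fin.
Qed.

Lemma in_L2_continuous u : continuous (fun t => complex.Re (u (expi t))) ->
  continuous (fun t => complex.Im (u (expi t))) -> in_L2 u.
Proof.
move=> cr ci; exists u; split; [exact: circle_measurable_fun|exact: circle_measurable_fun| |].
  exact: normL2sq_fin.
by apply: aeW.
Qed.

Lemma in_H1_C1 u : cCk 1 (fun t => u (expi t)) -> in_H1 u.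
Proof.
move=> [cr ci]; split.
  by apply: ac_abs_cont; apply: Ck_fun_ac; rewrite ?(ltW (two_pi_gt0 R)).
have /Ck_funS[_ /Ck_fun0 dr] := cr; have /Ck_funS[_ /Ck_fun0 di] := ci.
by apply: in_L2_continuous; under eq_fun do rewrite dtheta_expi.
Qed.

(** If f is nonzero at a point, it is nonzero on a ball around it, which has
    positive measure. *)
Lemma ae_eq0_continuous f a b : continuous f ->
  {ae mu, forall t, a < t < b -> f t = 0} -> forall t, a < t < b -> f t = 0.
Proof.
move=> cf [N [mN N0 fN]] t /andP[at' tb].
apply/eqP; apply/negPn/negP => ft.
have nft : \forall s \near t, f s != 0.
  exact: (cf t) (open_nbhs_nbhs (conj (@open_neq R 0) ft)).
have nab : \forall s \near t, a < s < b.
  near=> s; have : s \in `]a, b[ by near: s; apply: near_in_itvoo; rewrite in_itv/= at'.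
  by rewrite in_itv.
have /nbhs_ballP[e /= e0 eN] : \forall s \near t, a < s < b /\ f s != 0.
  by near=> s; split; near: s.
have : (mu (ball t e) <= mu N)%E.
  apply: le_measure; rewrite ?inE//; first exact: measurable_ball.
  move=> s /eN [sab fs]; apply: fN => /= /(_ sab) fs0.
  by rewrite fs0 eqxx in fs.
rewrite N0 (lebesgue_measure_ball _ (ltW e0)) lee_fin leNgt.
by rewrite pmulrn_lgt0// e0.
Unshelve. all: by end_near. Qed.

Lemma periodic_ae_eq0 f : continuous f -> periodic f T ->
  {ae mu, forall t, 0 < t < T -> f t = 0} -> forall t, f t = 0.
Proof.
move=> cf fT fae t; have f0 := ae_eq0_continuous cf fae.
have [s /andP[s0 sT] [k ->]] := periodic_reduce t.
rewrite (periodic_int fT); move: s0; rewrite le_eqVlt => /predU1P[<-|s0]; last first.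
  by apply: f0; rewrite s0.
apply/eqP; apply/negPn/negP => ft.
have nft : \forall s \near (0:R), f s != 0.
  exact: (cf 0) (open_nbhs_nbhs (conj (@open_neq R 0) ft)).
near (0:R)^'+ => r.
have : f r != 0 by near: r; exact: (cvg_within _ nft).
rewrite f0 ?eqxx//; apply/andP; split; near: r.
  exact: nbhs_right_gt.
by apply: nbhs_right_lt; exact: two_pi_gt0.
Unshelve. all: by end_near. Qed.

End circle_analysis.

(** * Periodic solutions of the Dirac and Hill equations *)

Section periodic_equations.
Variable R : realType.
Implicit Types (f g h q V W : R -> R) (c t : R).
Local Notation mu := (@lebesgue_measure R).
Local Notation T := (pi *+ 2 : R).

Lemma periodic_derive f h : periodic f T -> (forall t, is_derive t (1:R) f (h t)) ->
  periodic h T.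
Proof.
move=> fT fd t.
have H := is_derive_shift (fd (t + T)).
have E : (fun x => f (x + T)) = f by apply/funext => x; exact: fT.
by rewrite E in H; rewrite -(derive1_val (fd t)) (derive1_val H).
Qed.

(** The function f t exp (- c t) is constant, and it is multiplied by exp (- c
    T), which differs from 1, when t increases by a period T. *)
Lemma periodic_exp_eq0 f c : periodic f T ->
  (forall t, is_derive t (1:R) f (c * f t)) -> c != 0 -> forall t, f t = 0.
Proof.
move=> fT fd c0 t.
have gd s : is_derive s (1:R) (fun x => f x * expR (- c * x)) 0.
  have ed := is_derive1_comp (is_derive_expR (- c * s))
    (is_derive_scale (- c) (is_derive_id s (1:R))).
  apply: (is_derive_eq (is_deriveMl (fd s) ed)) => /=.
  by rewrite mulr1; ring.
have := is_derive_eq_cst gd (t + T) t; rewrite fT mulrDr expRD mulrA.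
move/eqP; rewrite -subr_eq0 -[X in _ - X]mulr1 -mulrBr mulf_eq0 subr_eq0.
rewrite mulf_eq0 (gt_eqF (expR_gt0 _)) orbF => /orP[/eqP//|].
rewrite -(@expR0 R) => /eqP/expR_inj/eqP; rewrite mulf_eq0 oppr_eq0 (negPf c0) /=.
by rewrite gt_eqF ?two_pi_gt0.
Qed.

(** Absolute continuity gives a modulus of uniform continuity on one period.
    Two close points fall into the same period after translation, or lie on
    either side of a common end point of periods, which then serves as an
    intermediate point. *)
Lemma periodic_ac_continuous f : ac f 0 T -> periodic f T -> continuous f.
Proof.
move=> acf fT x; apply/cvgrPdist_lt => eps eps0.
have T0 := two_pi_gt0 R.
have e2 : 0 < eps / 2 by rewrite divr_gt0.
have [eta eta0 fe] := ac_near acf e2.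
have close s t : s <= t -> t - s < eta -> t - s < T -> `|f s - f t| < eps.
  move=> st ts tsT.
  have [r /andP[r0 rT] [k sE]] := periodic_reduce s.
  have fs : f s = f r by rewrite sE periodic_int.
  have ft : f t = f (r + (t - s)).
    by rewrite -(periodic_int fT k (r + (t - s))); congr f; rewrite sE; ring.
  rewrite fs ft; have [le_T|lt_T] := leP (r + (t - s)) T.
    apply: (@lt_trans _ _ (eps / 2)); last by rewrite ltr_pdivrMr// ltr_pMr// ltr1n.
    apply: fe; first by rewrite r0 ltW.
      by rewrite le_T addr_ge0// subr_ge0.
    by rewrite distrC addrAC subrr add0r ger0_norm ?subr_ge0.
  have h1 : `|f r - f T| < eps / 2.
    apply: fe; [by rewrite r0 ltW|by rewrite lexx ltW|].
    by rewrite distrC ger0_norm; lra.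
  have h2 : `|f 0 - f (r + (t - s) - T)| < eps / 2.
    apply: fe; [by rewrite lexx ltW|by apply/andP; split; lra|].
    by rewrite sub0r normrN ger0_norm; lra.
  have e1 : f (r + (t - s)) = f (r + (t - s) - T) by rewrite -[in RHS]fT subrK.
  have e3 : f T = f 0 by rewrite -[in LHS](add0r T) fT.
  rewrite e1 -(subrKA (f T)) (splitr eps) {2}e3.
  by apply: le_lt_trans (ler_normD _ _) _; exact: ltrD.
have m0 : 0 < Num.min eta T by rewrite lt_min eta0.
near=> y.
have : `|x - y| < Num.min eta T by near: y; exact: cvgr_dist_lt.
rewrite lt_min => /andP[d1 d2].
have [xy|/ltW yx] := leP x y.
  by rewrite distrC ger0_norm ?subr_ge0// in d1; rewrite distrC ger0_norm ?subr_ge0// in d2; apply: close.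
rewrite ger0_norm ?subr_ge0// in d1; rewrite ger0_norm ?subr_ge0// in d2.
by rewrite distrC; apply: close.
Unshelve. all: by end_near. Qed.

(** On one period f differs from a primitive G of h by a constant. The
    increment of G over a period is constant, equal to that of f, which is
    zero; so G is periodic and f - G is constant on the whole line. *)
Lemma periodic_ac_derive f h : ac f 0 T -> periodic f T -> continuous h -> periodic h T ->
  {ae mu, forall t, 0 < t < T -> derive1 f t = h t} ->
  forall t, is_derive t (1:R) f (h t).
Proof.
move=> acf fT ch hT fh; have T0 := two_pi_gt0 R.
have [G dG] := continuous_antiderivative ch.
have fG := ac_derive1_eq T0 acf dG ch fh.
have GT : periodic G T.
  have kd s : is_derive s (1:R) (fun x => G (x + T) - G x) 0.
    apply: (is_derive_eq (is_deriveDl (is_derive_shift (dG (s + T))) (is_deriveNl (dG s)))).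
    by rewrite hT subrr.
  move=> t; apply/eqP; rewrite -subr_eq0.
  rewrite (is_derive_eq_cst kd t 0) add0r -fG ?lexx ?ltW//.
  by rewrite -[in f T](add0r T) fT subrr.
have fE t : f t = G t + (f 0 - G 0).
  have [r /andP[r0 rT] [k ->]] := periodic_reduce t.
  rewrite (periodic_int fT) (periodic_int GT).
  by have := fG r; rewrite r0 ltW// => /(_ isT) /eqP; rewrite subr_eq => /eqP ->; ring.
move=> t; rewrite (_ : f = (fun x => G x + (f 0 - G 0))); last exact/funext.
by apply: (is_derive_eq (is_deriveDl (dG t) (is_derive_const _ t))); rewrite addr0.
Qed.

Lemma hill_smooth h q : smooth q -> Ck_fun 2 h ->
  (forall t, derive1 (derive1 h) t = q t * h t) -> smooth h.
Proof.
move=> sq ch hE.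
have hE' : derive1 (derive1 h) = (fun t => q t * h t) by exact/funext.
have H k : Ck_fun k.+2 h.
  elim: k => [|k ih]; first exact: ch.
  move/Ck_funS: (ih) => [d1 /Ck_funS[d2 _]].
  apply/Ck_funS; split; [exact: d1|apply/Ck_funS; split; first exact: d2].
  by rewrite hE'; apply: Ck_funM; [exact: sq|exact: Ck_funW].
by move=> k; apply: Ck_funW; apply: Ck_funW; exact: H.
Qed.

(** The eigenvalue equation in the summand of index n, for real functions: V
    is the second component of the spinor, W the first divided by d. *)
Definition dirac_system (d : R -> R) (n lambda : R) V W :=
  forall t, is_derive t (1:R) V (n * V t + lambda * d t ^+ 2 * W t) /\
            is_derive t (1:R) W (- n * W t - lambda * V t).

Definition hill (d : R -> R) (n lambda : R) h :=
  Ck_fun 2 h /\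
  forall t, derive1 (derive1 h) t = (n ^+ 2 - lambda ^+ 2 * d t ^+ 2) * h t.

Section dirac_hill.
Variables (d : R -> R) (n lambda : R).
Hypothesis sd : smooth d.

Lemma dirac_system_C1 V W : dirac_system d n lambda V W -> Ck_fun 1 V /\ Ck_fun 1 W.
Proof.
move=> VW; have dV t := (VW t).1; have dW t := (VW t).2.
have cV := is_derive_continuous dV; have cW := is_derive_continuous dW.
split.
- apply: (Ck_fun_is_derive dV); apply: Ck_funD.
    by apply: Ck_funZ; exact/Ck_fun0.
  apply: Ck_funM; last exact/Ck_fun0.
  by apply: Ck_funZ; apply: (Ck_funM (sd 0) (sd 0)).
- apply: (Ck_fun_is_derive dW); apply: Ck_funB.
    by apply: Ck_funZ; exact/Ck_fun0.
  by apply: Ck_funZ; exact/Ck_fun0.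
Qed.

Lemma dirac_system_hill V W : dirac_system d n lambda V W -> hill d n lambda W.
Proof.
move=> VW; have [cV cW] := dirac_system_C1 VW.
have dV t := (VW t).1; have dW t := (VW t).2.
have E : derive1 W = (fun t => - n * W t - lambda * V t).
  by apply/funext => t; exact: derive1_val.
split.
  by apply: (Ck_fun_is_derive dW); apply: Ck_funB; exact: Ck_funZ.
move=> t; rewrite E; apply: derive1_val.
apply: (is_derive_eq (is_deriveDl (is_derive_scale (- n) (dW t))
  (is_deriveNl (is_derive_scale lambda (dV t))))).
by ring.
Qed.

(** The second equation of the system defines V in terms of W = h. *)
Lemma hill_dirac_system h : lambda != 0 -> hill d n lambda h ->
  dirac_system d n lambda (fun t => - lambda^-1 * (derive1 h t + n * h t)) h.
Proof.
move=> l0 [ch hE] t; have dh := Ck_fun_derive ch.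
have ddh := Ck_fun_derive ((Ck_funS _ _).1 ch).2.
split.
  apply: (is_derive_eq (is_derive_scale (- lambda^-1)
    (is_deriveDl (ddh t) (is_derive_scale n (dh t))))).
  by rewrite hE; field.
by apply: (is_derive_eq (dh t)); field.
Qed.

(** The equation factors as (D + n) (D - n) h = 0, with D the derivation, and
    both factors are injective on periodic functions when n is not 0. *)
Lemma periodic_hill0 h : lambda = 0 -> hill d n lambda h -> periodic h T ->
  n != 0 -> forall t, h t = 0.
Proof.
move=> l0 [ch hE] hT n0; have dh := Ck_fun_derive ch.
have ddh := Ck_fun_derive ((Ck_funS _ _).1 ch).2.
have h'T := periodic_derive hT dh.
have P0 : forall t, derive1 h t - n * h t = 0.
  apply: (@periodic_exp_eq0 (fun t => derive1 h t - n * h t) (- n)); rewrite ?oppr_eq0//.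
    by move=> t; rewrite h'T hT.
  move=> t; apply: (is_derive_eq (is_deriveDl (ddh t) (is_deriveNl (is_derive_scale n (dh t))))).
  by rewrite hE l0; ring.
apply: (@periodic_exp_eq0 h n) => // t; apply: (is_derive_eq (dh t)).
by apply/eqP; rewrite -subr_eq0 P0.
Qed.

(** A nonzero periodic solution of one of the equations V' = n V and W' = - n
    W forces n = 0, and the Hill equation is then h'' = 0. *)
Lemma dirac_system0_hill V W t0 : lambda = 0 -> dirac_system d n lambda V W ->
  periodic V T -> periodic W T -> V t0 != 0 \/ W t0 != 0 -> hill d n lambda (fun=> 1).
Proof.
move=> l0 VW VT WT VW0.
have n0 : n = 0.
  apply/eqP; apply: contrapT => /negP nn0.
  have V0 : V t0 = 0.
    apply: (@periodic_exp_eq0 V n) => // t; apply: (is_derive_eq (VW t).1).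
    by rewrite l0; ring.
  have W0 : W t0 = 0.
    apply: (@periodic_exp_eq0 W (- n)); rewrite ?oppr_eq0// => t.
    by apply: (is_derive_eq (VW t).2); rewrite l0; ring.
  by case: VW0; rewrite ?V0 ?W0 eqxx.
split; first exact: Ck_fun_cst.
move=> t; have -> : derive1 (fun=> 1 : R) = (fun=> 0).
  by apply/funext => s; exact: derive1_val (is_derive_const 1 s).
by rewrite (derive1_val (is_derive_const 0 t)) n0 l0; ring.
Qed.

End dirac_hill.
End periodic_equations.

(** * Eigenvalues of the deformed Dirac operator *)

Section dirac_operator.
Variable R : realType.
Implicit Types (u v : circle R -> R[i]).
Local Notation T := (pi *+ 2 : R).

(** The coefficients of all the equations are real, so the real and the
    imaginary parts of a complex solution are treated at once, the boolean
    selecting one of them. *)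
Definition cpart (b : bool) (z : R[i]) : R := if b then complex.Im z else complex.Re z.

Lemma cpartD b (z w : R[i]) : cpart b (z + w) = cpart b z + cpart b w.
Proof. by case: b z w => -[? ?] [? ?]. Qed.

Lemma cpartN b (z : R[i]) : cpart b (- z) = - cpart b z.
Proof. by case: b z => -[]. Qed.

Lemma cpartZ b (a : R) (z : R[i]) : cpart b (a%:C * z) = a * cpart b z.
Proof. by case: b z => -[x y] /=; rewrite mul0r ?subr0 ?addr0. Qed.

Lemma cpart_cderive b (g : R -> R[i]) t :
  cpart b (cderive g t) = derive1 (fun s => cpart b (g s)) t.
Proof. by case: b. Qed.

Lemma cpart_eq (z w : R[i]) : (forall b, cpart b z = cpart b w) -> z = w.
Proof.
move=> E; apply/eqP; rewrite eq_complex; apply/andP; split; apply/eqP.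
  exact: (E false).
exact: (E true).
Qed.

Lemma cpart0 b : cpart b 0 = 0. Proof. by case: b. Qed.

Lemma cCk_cpart k (g : R -> R[i]) : cCk k g <-> forall b, Ck_fun k (fun t => cpart b (g t)).
Proof. by split=> [[? ?] []//|H]; split; [exact: (H false)|exact: (H true)]. Qed.

Lemma intr_complex (n : int) : (n%:~R : R[i]) = (n%:~R)%:C.
Proof. by rewrite (rmorph_int (real_complex R)). Qed.

Lemma esum_single (g : int -> \bar R) n : (forall m, (0 <= g m)%E) ->
  (forall m, m != n -> g m = 0%E) -> (\esum_(m in [set: int]) g m = g n)%E.
Proof.
move=> g0 gn; rewrite -(@esum_set1 R int n g)//.
rewrite [RHS]esum_mkcond; apply: eq_esum => m _.
case: ifPn => // /negP mn; apply: gn; apply/eqP => mE.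
by apply: mn; rewrite mE inE.
Qed.

Section spectrum.
Variables (f : circle_diffeo R) (d : int -> R -> R).
Hypothesis sd : forall n, smooth (d n).
Hypothesis d0 : forall n t, d n t != 0.
Hypothesis dE : forall n t, delta f n (expi t) = (d n t)%:C.

Lemma periodic_d n : periodic (d n) T.
Proof.
move=> t; have := dE n (t + T); rewrite expiD2pi dE.
by move=> /(congr1 (cpart false)).
Qed.

(** Holds for arbitrary functions, as the total derivative is taken
    componentwise. *)
Lemma D_omega_n1 n (x : spinor R) b t :
  cpart b ((D_omega_n f n x).1 (expi t)) =
  (d n t)^-1 * (derive1 (fun s => cpart b (x.2 (expi s))) t - n%:~R * cpart b (x.2 (expi t))).
Proof.
rewrite /= /mult_op dE -fmorphV cpartZ /L_op izdz dtheta_expi intr_complex.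
by rewrite cpartD cpartN cpartZ cpart_cderive.
Qed.

Lemma D_omega_n2 n (x : spinor R) b t :
  let w s := (d n s)^-1 * cpart b (x.1 (expi s)) in
  cpart b ((D_omega_n f n x).2 (expi t)) = - derive1 w t - n%:~R * w t.
Proof.
move=> w; rewrite /= /Lstar_op izdz dtheta_expi intr_complex.
rewrite cpartD !cpartN cpartZ cpart_cderive /mult_op.
have E s : cpart b ((delta f n (expi s))^-1 * x.1 (expi s)) = w s.
  by rewrite dE -fmorphV cpartZ.
by rewrite E; under eq_fun do rewrite E.
Qed.

(** Some summand of the eigenvector is not zero almost everywhere. Its
    components give absolutely continuous periodic functions V and W
    satisfying the system almost everywhere, whose right-hand sides are
    continuous, so the system holds everywhere. Either the real or the
    imaginary part is then a nonzero solution. *)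
Lemma eigenvalue_dirac_system lambda : D_omega_eigenvalue f lambda%:C ->
  exists n V W, [/\ periodic V T, periodic W T, dirac_system (d n) n%:~R lambda V W &
    exists t, V t != 0 \/ W t != 0].
Proof.
move=> [xi [[xiH1 _ _] xi_neq0 Dxi]].
have [n xin] : exists n, ~ spinor_ae_eq (xi n) (fun=> 0, fun=> 0).
  by apply/existsNP.
pose x := xi n.
have [[acu _] [acv _]] := xiH1 n.
have [/circle_ae_expi D1 /circle_ae_expi D2] := Dxi n.
pose V b t := cpart b (x.2 (expi t)).
pose W b t := (d n t)^-1 * cpart b (x.1 (expi t)).
have VT b : periodic (V b) T by move=> t; rewrite /V expiD2pi.
have WT b : periodic (W b) T by move=> t; rewrite /W expiD2pi periodic_d.
have T0 := two_pi_gt0 R.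
have acV b : ac (V b) 0 T.
  by have [r i] := abs_cont_ac acv; case: b.
have acW b : ac (W b) 0 T.
  apply: acM; [exact: ltW| |by have [r i] := abs_cont_ac acu; case: b].
  apply: Ck_fun_ac; first exact: ltW.
  exact: (Ck_funV (@d0 n) (sd n 1)).
have cV b := periodic_ac_continuous (acV b) (VT b).
have cW b := periodic_ac_continuous (acW b) (WT b).
have sys b : dirac_system (d n) n%:~R lambda (V b) (W b).
  move=> t; split; move: t.
  - apply: periodic_ac_derive => //.
    + apply: (@Ck_fun_continuous _ 0); apply: Ck_funD.
        by apply: Ck_funZ; exact/Ck_fun0.
      apply: Ck_funM; last exact/Ck_fun0.
      by apply: Ck_funZ; apply: (Ck_funM (sd n 0) (sd n 0)).
    + by move=> t; rewrite VT WT periodic_d.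
    + move: D1; apply: filterS; first exact: (ae_filter_ringOfSetsType lebesgue_measure).
      move=> t /= H t0T; have /(congr1 (cpart b)) := H t0T.
      rewrite D_omega_n1 cpartZ => /(congr1 ( *%R (d n t))).
      rewrite mulVKf// => /eqP; rewrite subr_eq => /eqP ->.
      by rewrite /V /W /x; field.
  - apply: periodic_ac_derive => //.
    + apply: (@Ck_fun_continuous _ 0); apply: Ck_funB.
        by apply: Ck_funZ; exact/Ck_fun0.
      by apply: Ck_funZ; exact/Ck_fun0.
    + by move=> t; rewrite VT WT.
    + move: D2; apply: filterS; first exact: (ae_filter_ringOfSetsType lebesgue_measure).
      move=> t /= H t0T; have /(congr1 (cpart b)) := H t0T.
      rewrite D_omega_n2 cpartZ -/(W b t) => E.
      by rewrite /V /x -E /W /x; ring.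
have [b [t VW]] : exists b t, V b t != 0 \/ W b t != 0.
  apply: contrapT => /forallNP H; apply: xin.
  have VW0 b t : V b t = 0 /\ W b t = 0.
    have /forallNP/(_ t) /not_orP [/negP V0 /negP W0] := H b.
    by move: V0 W0; rewrite !negbK => /eqP -> /eqP ->.
  split; apply: aeW => z _; have [t <-] := expi_surj z; apply: cpart_eq => b; rewrite cpart0.
  - have /eqP := (VW0 b t).2; rewrite mulf_eq0 invr_eq0 (negPf (d0 _ _)) => /eqP E.
    exact: E.
  - exact: (VW0 b t).1.
by exists n, (V b), (W b); split=> //; exists t.
Qed.

Lemma D_omega_n0 n : D_omega_n f n (fun=> 0, fun=> 0) = (fun=> 0, fun=> 0).
Proof.
have d00 t : derive1 (fun=> 0 : R) t = 0 by exact: derive1_val (is_derive_const 0 t).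
rewrite [LHS]surjective_pairing; congr pair; apply/funext => z;
  have [t <-] := expi_surj z; apply: cpart_eq => b.
- rewrite D_omega_n1/=; under eq_fun do rewrite cpart0.
  by rewrite d00 !cpart0 mulr0 subr0 mulr0.
- rewrite D_omega_n2/=; under eq_fun do rewrite cpart0 mulr0.
  by rewrite d00 cpart0 !mulr0 subr0 oppr0.
Qed.

Lemma normL2sq0 : normL2sq (fun _ : circle R => 0 : R[i]) = 0%E.
Proof.
rewrite /normL2sq (eq_integral (fun=> 0%E)) ?integral0// => z _ /=.
by rewrite !expr0n /= addr0 sqrtr0 expr0n.
Qed.

Lemma normL2sq_ge0 u : (0 <= normL2sq u)%E.
Proof. by apply: integral_ge0 => z _; rewrite lee_fin sqr_ge0. Qed.

(** The eigenvector has the single nonzero summand (d W, V), in the position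
    n. It is continuously differentiable, so all the norms are finite. If it
    were zero almost everywhere, V and W would vanish by continuity. *)
Lemma dirac_system_eigenvalue lambda n V W t0 :
    periodic V T -> periodic W T -> dirac_system (d n) n%:~R lambda V W ->
    V t0 != 0 \/ W t0 != 0 ->
  D_omega_eigenvalue f lambda%:C.
Proof.
move=> VT WT VW VW0; have [cV cW] := dirac_system_C1 (sd n) VW.
have cU : Ck_fun 1 (fun t => d n t * W t) by exact: (Ck_funM (sd n 1) cW).
have UT : periodic (fun t => d n t * W t) T by move=> t; rewrite WT periodic_d.
have mul1C (z : R[i]) : 1%:C * z = z by exact: mul1r.
have realize (g : R -> R) : periodic g T -> Ck_fun 1 g -> exists w : circle R -> R[i],
    [/\ forall t, w (expi t) = (g t)%:C, cCk 1 (fun t => w (expi t)) &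
        forall l : R, (normL2sq (fun y => l%:C * w y)%R < +oo)%E].
  move=> gT cg; have gcT : periodic (fun t => (g t)%:C) T by move=> t; rewrite gT.
  have [w wE] := periodic_descend gcT; exists w.
  have C1 (l : R) : forall b, Ck_fun 1 (fun t => cpart b (l%:C * w (expi t))).
    move=> b; under eq_fun do rewrite cpartZ wE.
    by apply: Ck_funZ; case: b; [exact: Ck_fun_cst|exact: cg].
  split; first exact: wE.
    by apply/cCk_cpart => b; have := C1 1 b; under eq_fun do rewrite mul1C.
  move=> l; apply: normL2sq_fin.
    exact: Ck_fun_continuous (C1 l false).
  exact: Ck_fun_continuous (C1 l true).
have [u [uE cu uL2]] := realize _ UT cU; have [v [vE cv vL2]] := realize _ VT cV.
pose x : spinor R := (u, v).
have Dx : D_omega_n f n x = (fun z => lambda%:C * u z, fun z => lambda%:C * v z).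
  rewrite [LHS]surjective_pairing; congr pair; apply/funext => z;
    have [t <-] := expi_surj z; apply: cpart_eq => b.
  - rewrite D_omega_n1 cpartZ /=; under eq_fun do rewrite vE.
    rewrite vE uE; case: b => /=.
      by rewrite (derive1_val (is_derive_const 0 t)) !mulr0 subr0 mulr0.
    by rewrite (derive1_val (VW t).1); field.
  - rewrite D_omega_n2 cpartZ /=; under eq_fun do rewrite uE.
    rewrite vE uE; case: b => /=.
      under eq_fun do rewrite mulr0.
      by rewrite (derive1_val (is_derive_const 0 t)) !mulr0 subr0 oppr0.
    have E s : (d n s)^-1 * (d n s * W s) = W s by rewrite mulKf.
    under eq_fun do rewrite E.
    by rewrite E (derive1_val (VW t).2); ring.
pose xi m : spinor R := if m == n then x else (fun=> 0, fun=> 0).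
have xin : xi n = x by rewrite /xi eqxx.
have xim m : m != n -> xi m = (fun=> 0, fun=> 0) by rewrite /xi => /negPf ->.
exists xi; split.
- have c0 : cCk 1 (fun t : R => 0 : R[i]) by split; exact: Ck_fun_cst.
  have n0 (y : spinor R) : (0 <= spinor_normsq y)%E by rewrite adde_ge0// normL2sq_ge0.
  split.
  + move=> m; have [->|mn] := eqVneq m n; first by rewrite xin; split; exact: in_H1_C1.
    by rewrite (xim _ mn); split; exact: in_H1_C1.
  + rewrite (@esum_single _ n)// => [|m mn]; last by rewrite xim// /spinor_normsq normL2sq0 adde0.
    rewrite xin; apply: lte_add_pinfty.
      by have := uL2 1; under eq_fun do rewrite mul1C; apply.
    by have := vL2 1; under eq_fun do rewrite mul1C; apply.
  + rewrite (@esum_single _ n)// => [|m mn].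
      rewrite /D_omega xin Dx; apply: lte_add_pinfty; [exact: uL2|exact: vL2].
    by rewrite /D_omega xim// D_omega_n0 /spinor_normsq normL2sq0 adde0.
- move=> /(_ n); rewrite xin => -[/circle_ae_expi u0 /circle_ae_expi v0].
  have aeF := ae_filter_ringOfSetsType (@lebesgue_measure R).
  have V0 : V t0 = 0.
    apply: (@periodic_ae_eq0 R V) => //; first exact: Ck_fun_continuous cV.
    move: v0; apply: filterS => t /= H /H; rewrite vE.
    by move/(congr1 (cpart false)).
  have W0 : d n t0 * W t0 = 0.
    apply: (@periodic_ae_eq0 R (fun t => d n t * W t)) => //; first exact: Ck_fun_continuous cU.
    move: u0; apply: filterS => t /= H /H; rewrite uE.
    by move/(congr1 (cpart false)).
  move/eqP: W0; rewrite mulf_eq0 (negPf (d0 _ _)) /= => /eqP W0.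
  by case: VW0; rewrite ?V0 ?W0 eqxx.
- move=> m; have [->|mn] := eqVneq m n.
    by rewrite /D_omega xin Dx; split; apply: aeW.
  by rewrite /D_omega xim// D_omega_n0; split; apply: aeW => z _ /=; rewrite mulr0.
Qed.

Lemma hill_solutionP lambda n (H : R -> R[i]) :
  hill_solution f lambda n H <-> forall b, hill (d n) n%:~R lambda (fun t => cpart b (H t)).
Proof.
have E t b : cpart b (cderive (cderive H) t
            + ((lambda%:C) ^+ 2 * (d_fun f n t) ^+ 2 - n%:~R ^+ 2) * H t) =
    derive1 (derive1 (fun s => cpart b (H s))) t -
    (n%:~R ^+ 2 - lambda ^+ 2 * d n t ^+ 2) * cpart b (H t).
  rewrite /d_fun dE intr_complex -!rmorphXn -rmorphM -rmorphB cpartD cpartZ.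
  rewrite cpart_cderive; under [in LHS]eq_fun do rewrite cpart_cderive.
  by rewrite -mulNr opprB.
split=> [[/cCk_cpart cH eqH] b|hH].
  split=> [|t]; first exact: cH.
  by apply/eqP; rewrite -subr_eq0 -E eqH cpart0.
split; first by apply/cCk_cpart => b; case: (hH b).
move=> t; apply: cpart_eq => b; rewrite E cpart0; apply/eqP; rewrite subr_eq0.
by apply/eqP; case: (hH b).
Qed.

End spectrum.
End dirac_operator.

Unset Implicit Arguments.
Set Strict Implicit.

Theorem theorem8p1 (R : realType) (alpha : R) (f : circle_diffeo R) :
  irrational alpha ->
  orientation_preserving f ->
  has_rotation_number f (2 * alpha) ->
  (forall lambda : R,
     D_omega_eigenvalue f lambda%:C <->
     exists (n : int) (H : R -> R[i]),
       [/\ hill_solution f lambda n H,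
           periodic H (pi *+ 2) &
           exists t, H t != 0]) /\
  (forall (lambda : R) (n : int) (H : R -> R[i]),
     hill_solution f lambda n H -> periodic H (pi *+ 2) -> cCinfty H).
Proof.
move=> _ _ _.
have [d dP] := choice (deltaE f).
have sd n : smooth (d n) by case: (dP n).
have d0 n t : d n t != 0 by case: (dP n).
have dE n t : delta f n (expi t) = (d n t)%:C by case: (dP n).
split.
- move=> lambda; split.
  + move=> /(eigenvalue_dirac_system sd d0 dE)[n [V [W [VT WT VW [t VW0]]]]].
    have realH (h : R -> R) : hill (d n) n%:~R lambda h ->
        hill_solution f lambda n (fun t => (h t)%:C).
      move=> hh; apply/(hill_solutionP dE) => -[]//=; split; first exact: Ck_fun_cst.
      move=> s; have -> : derive1 (fun=> 0 : R) = (fun=> 0).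
        by apply/funext => r; exact: derive1_val (is_derive_const 0 r).
      by rewrite (derive1_val (is_derive_const 0 s)) mulr0.
    have [l0|l0] := eqVneq lambda 0.
      exists n, (fun=> 1%:C); split=> //; last by exists 0; exact: oner_neq0.
      by apply: realH; exact: dirac_system0_hill l0 VW VT WT VW0.
    exists n, (fun t => (W t)%:C); split.
    * by apply: realH; exact: dirac_system_hill VW.
    * by move=> s; rewrite WT.
    * apply: contrapT => /forallNP W0.
      have W00 s : W s = 0.
        have /negP := W0 s; rewrite negbK => /eqP /(congr1 (cpart false)).
        exact.
      case: VW0; last by rewrite W00 eqxx.
      have := derive1_val (VW t).2.
      rewrite (_ : W = (fun=> 0)); last exact/funext.
      rewrite (derive1_val (is_derive_const 0 t)) mulr0 add0r => /eqP.
      by rewrite eq_sym oppr_eq0 mulf_eq0 (negPf l0) => /= ->.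
  + move=> [n [H [/(hill_solutionP dE) hH HT [t Ht]]]].
    have [b hbt] : exists b, cpart b (H t) != 0.
      apply: contrapT => /forallNP h0; move/eqP: Ht; apply; apply: cpart_eq => b.
      by have /negP := h0 b; rewrite negbK cpart0 => /eqP.
    have hT : periodic (fun s => cpart b (H s)) (pi *+ 2) by move=> s; rewrite HT.
    have [l0|l0] := eqVneq lambda 0.
      have n0 : (n%:~R : R) = 0.
        apply/eqP; apply: contrapT => /negP n0.
        by move: hbt; rewrite (periodic_hill0 l0 (hH b) hT n0) eqxx.
      apply: (dirac_system_eigenvalue sd d0 dE (n := n) (V := fun=> 1) (W := fun=> 0) (t0 := 0)) => //.
        move=> s; rewrite n0 l0; split.
          by apply: (is_derive_eq (is_derive_const 1 s)); ring.
        by apply: (is_derive_eq (is_derive_const 0 s)); ring.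
      by left; exact: oner_neq0.
    have sys := hill_dirac_system l0 (hH b).
    apply: (dirac_system_eigenvalue sd d0 dE _ hT sys (t0 := t)); last by right.
    have h'T := periodic_derive hT (Ck_fun_derive (hH b).1).
    by move=> s; rewrite h'T hT.
- move=> lambda n H /(hill_solutionP dE) hH _.
  have sH b : smooth (fun t => cpart b (H t)).
    have [cH HE] := hH b; apply: hill_smooth cH HE.
    move=> k; apply: Ck_funB; first exact: Ck_fun_cst.
    by apply: Ck_funZ; exact: (Ck_funM (sd n k) (sd n k)).
  by move=> k; apply/cCk_cpart => b; exact: sH.
Qed.
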